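(* Let $p\in\mathbb N$, $m\in\mathbb Z$, $\alpha\in\mathbb R$, $\beta>0$ with $\alpha+p\beta>0$, $\mu>0$ and $-1\le B_j<A_j\le1$ for $j=1,2$. If the functions $f_1,f_2\in\mathcal A_p$ satisfy $$(1-\mu)\frac{\Theta_p^m(\alpha,\beta)f_j(z)}{z^p}+\mu\frac{\Theta_p^{m+1}(\alpha,\beta)f_j(z)}{z^p}\prec\frac{1+A_jz}{1+B_jz}\quad(z\in\mathbb U;\ j=1,2),$$ and $\mathcal H(z)=\Theta_p^m(\alpha,\beta)(f_1\star f_2)(z)$ $(z\in\mathbb U)$, then $$\operatorname{Re}\left\{(1-\mu)\frac{\Theta_p^m(\alpha,\beta)\mathcal H(z)}{z^p}+\mu\frac{\Theta_p^{m+1}(\alpha,\beta)\mathcal H(z)}{z^p}\right\}>\eta\quad(0\le\eta<1;\ z\in\mathbb U),$$ where $$\eta=1-\frac{4(A_1-B_1)(A_2-B_2)}{(1-B_1)(1-B_2)}\left\{1-\frac12\,{}_2F_1\left(1,1;\frac{\alpha+p\beta}{\mu\beta}+1;\frac12\right)\right\}.$$ The result is the best possible when $B_1=B_2=-1$.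
   Context: $\mathbb U=\{z\in\mathbb C:|z|<1\}$. $\mathcal A_p$ is the class of functions $f(z)=z^p+\sum_{k\ge p+1}a_kz^k$ which are analytic and $p$-valent in $\mathbb U$. For $m\in\mathbb Z$ the linear operator $\Theta_p^m(\alpha,\beta)$ on $\mathcal A_p$ is $$\Theta_p^m(\alpha,\beta)f(z)=z^p+\sum_{k=p+1}^\infty\left(\frac{\alpha+k\beta}{\alpha+p\beta}\right)^m a_kz^k .$$ The Hadamard product of $f=z^p+\sum a_kz^k$ and $g=z^p+\sum b_kz^k$ is $(f\star g)(z)=z^p+\sum_{k\ge p+1}a_kb_kz^k$. For functions $F,G$ analytic in $\mathbb U$, $F\prec G$ means $F=G\circ w$ for some analytic $w:\mathbb U\to\mathbb U$ with $w(0)=0$. ${}_2F_1$ is the Gauss hypergeometric function.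
   Formalization: The class A_p is taken as all analytic f(z)=z^p+..., without requiring p-valence in U; with p-valence ''best possible'' fails (p=1, α=0, β=μ=1, m=-10, A_j=0, B_j=-1: the real part exceeds 0.99 > η=ln 2). Sharpness is over this larger class. *)

(* Defs.v *)
From Stdlib Require Import Reals ZArith.
From Coquelicot Require Import Coquelicot.
Open Scope R_scope.

Definition in_U (z : C) : Prop := Cmod z < 1.

Definition analytic_in_U (f : C -> C) : Prop :=
  forall z : C, in_U z -> @ex_derive C_AbsRing C_NormedModule f z.

Definition has_expansion (f : C -> C) (a : nat -> C) : Prop :=
  forall z : C, in_U z -> @is_pseries C_AbsRing C_NormedModule a z (f z).

(* [iota] is Coquelicot's definite description: the k-th Taylor coefficient of
   f at 0 is determined by f as soon as f has an expansion in U. *)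
Definition coef (f : C -> C) (k : nat) : C :=
  @iota C_CompleteNormedModule
    (fun c : C => exists a : nat -> C, has_expansion f a /\ c = a k).

(* Sum of a complex power series (meaningful where the series converges). *)
Definition CPSeries (a : nat -> C) (z : C) : C :=
  @iota C_CompleteNormedModule
    (fun l : C => @is_pseries C_AbsRing C_NormedModule a z l).

(* Coefficients of z^p + sum_{k >= p+1} a_k z^k. *)
Definition normalized (p : nat) (a : nat -> C) (k : nat) : C :=
  if Nat.ltb k p then RtoC 0
  else if Nat.eqb k p then RtoC 1
  else a k.

(* The class A_p: f analytic in U with f(z) = z^p + sum_{k >= p+1} a_k z^k.
   "p-valent" is read as: f has a zero of order exactly p at the origin, which
   the normalization expresses. Global p-valence in U is not imposed: it is
   preserved neither by [Theta] nor by [hadamard], so those would not be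
   operations on the class, and sharpness of the bound for each fixed m would
   fail (for p = 1 and m very negative, |a_k| <= k for univalent f forces a
   strictly better bound). *)
Definition Ap (p : nat) (f : C -> C) : Prop :=
  analytic_in_U f /\
  exists a : nat -> C, has_expansion f (normalized p a).

Definition Theta (p : nat) (m : Z) (alpha beta : R) (f : C -> C) : C -> C :=
  CPSeries (normalized p (fun k =>
    (RtoC (powerRZ ((alpha + INR k * beta) / (alpha + INR p * beta)) m)
     * coef f k)%C)).

Definition hadamard (p : nat) (f g : C -> C) : C -> C :=
  CPSeries (normalized p (fun k => (coef f k * coef g k)%C)).

(* F(z)/z^p for F with a zero of order at least p at 0; the removable
   singularity at 0 is filled by the limit, i.e. the coefficient of z^p. *)
Definition div_zp (p : nat) (F : C -> C) (z : C) : C :=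
  if Ceq_dec z (RtoC 0) then coef F p else (F z / Cpow z p)%C.

Definition Theta_mix (p : nat) (m : Z) (alpha beta mu : R) (f : C -> C)
    (z : C) : C :=
  (RtoC (1 - mu) * div_zp p (Theta p m alpha beta f) z
   + RtoC mu * div_zp p (Theta p (m + 1)%Z alpha beta f) z)%C.

Definition subordinate (F G : C -> C) : Prop :=
  exists w : C -> C,
    analytic_in_U w /\
    (forall z : C, in_U z -> in_U (w z)) /\
    w (RtoC 0) = RtoC 0 /\
    (forall z : C, in_U z -> F z = G (w z)).

Definition janowski (A B : R) (z : C) : C :=
  ((RtoC 1 + RtoC A * z) / (RtoC 1 + RtoC B * z))%C.

Fixpoint pochhammer (a : R) (n : nat) : R :=
  match n with
  | O => 1
  | S k => pochhammer a k * (a + INR k)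
  end.

Definition hyp2F1 (a b c x : R) : R :=
  PSeries (fun n => pochhammer a n * pochhammer b n
                    / (pochhammer c n * INR (fact n))) x.

Definition Re_bound (p : nat) (m : Z) (alpha beta mu A1 B1 A2 B2 c : R)
    : Prop :=
  forall f1 f2 : C -> C,
    Ap p f1 -> Ap p f2 ->
    subordinate (Theta_mix p m alpha beta mu f1) (janowski A1 B1) ->
    subordinate (Theta_mix p m alpha beta mu f2) (janowski A2 B2) ->
    let H := Theta p m alpha beta (hadamard p f1 f2) in
    forall z : C, in_U z -> Re (Theta_mix p m alpha beta mu H z) > c.

(* Main.v *)
(** Write [g = (alpha + p beta) / (mu beta)] and [d n = g / (g + n)]. If [c1], [c2]
    are the Taylor coefficients of the two functions assumed subordinate, those
    of the function to be estimated are [d n * c1 n * c2 n]. Subordination is only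
    used through [Re > (1 - A) / (1 - B)], which turns [c1], [c2] into
    coefficients of Caratheodory functions [q1], [q2]. Convolving with such
    a function preserves lower bounds on the real part (the Fourier
    coefficients of the positive measure [Re q] are half those of [q]), so it
    remains to minimise the real part of [T z = sum (d n * z ^ n)]. Along a ray,
    [t T' + g T = g / (1 - t zeta)], and comparing real parts with the case
    [zeta = -1] gives [Re (T z) >= T (- |z|)]. Finally [T (- t)] is identified with
    its Pfaff transform because both solve the same equation; this is smooth up
    to [t = 1], where it takes the value occurring in the theorem. For
    [B1 = B2 = -1] the functions with [c_j n = 1 + A_j] attain the bound in the
    limit [z -> -1]. *)

Require Import Defs.
From Stdlib Require Import Reals ZArith Lra Lia.
From Coquelicot Require Import Coquelicot.
Open Scope R_scope.

(** * Complex power series on the unit disc *)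

(** The positive measure is never constructed. Its role is played by averages over roots of unity of
    truncated series, where only finite sums occur. The obstacle is that truncating a series can
    destroy the sign of its real part; the constant terms therefore receive a slack [eps], the
    truncation is chosen uniformly on a circle of radius below 1, and [eps] is removed at the end.
    Hence all estimates live on radii [r < 1], and the strict inequality of the theorem comes from
    the strict decrease of [pfaff] between [r] and 1.

    The factor 4 in the bound arises because each convolution turns a lower bound [c] into
    [2 * c - 1], and two of them turn [T] into [4 * T - 3], that is [1 - 4 * (1 - T)].

    The integral formula for [T] is replaced by its differential equation. This equation is singular
    at 0, and the singularity helps: it determines the value at 0, so that solutions can be compared
    without an initial condition. *)

Notation cseries := (@is_series C_AbsRing C_NormedModule).
Notation cpseries := (@is_pseries C_AbsRing C_NormedModule).
Definition csum (u : nat -> C) (n : nat) : C := @sum_n C_AbelianMonoid u n.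

Lemma csum_S (u : nat -> C) (n : nat) : csum u (S n) = (csum u n + u (S n))%C.
Proof. exact (sum_Sn u n). Qed.

Lemma csum_0 (u : nat -> C) : csum u 0 = u 0%nat.
Proof. exact (sum_O u). Qed.

Lemma pow_n_Cpow (z : C) (n : nat) : @pow_n C_Ring z n = (z ^ n)%C.
Proof.
  induction n as [|n IH]; [reflexivity|].
  simpl; rewrite IH; reflexivity.
Qed.

Lemma cpseries_series (a : nat -> C) (z l : C) :
  cpseries a z l <-> cseries (fun n => (a n * z ^ n)%C) l.
Proof.
  assert (E : forall n, scal (@pow_n C_Ring z n) (a n : C_NormedModule)
                        = (a n * z ^ n)%C).
  { intros n; rewrite pow_n_Cpow; change (z ^ n * a n = a n * z ^ n)%C; ring. }
  split; apply is_series_ext; intros n; [|symmetry]; apply E.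
Qed.

Lemma cseries_eps (u : nat -> C) (l : C) :
  cseries u l <->
  forall eps, 0 < eps ->
    exists N, forall n, (N <= n)%nat -> Cmod (csum u n - l) < eps.
Proof.
  pose proof (filterlim_locally_ball_norm (K := C_AbsRing) (U := C_NormedModule)
                (F := eventually) (csum u) l) as E.
  split.
  - intros H eps He.
    destruct (proj1 E H (mkposreal eps He)) as [N HN]; exists N; intros n Hn.
    exact (HN n Hn).
  - intros H; apply (proj2 E); intros [eps He].
    destruct (H eps He) as [N HN]; exists N; intros n Hn.
    exact (HN n Hn).
Qed.

Lemma cseries_unique (u : nat -> C) (l1 l2 : C) :
  cseries u l1 -> cseries u l2 -> l1 = l2.
Proof. apply (filterlim_locally_unique (V := C_NormedModule)). Qed.

Lemma cpseries_unique (a : nat -> C) (z l1 l2 : C) :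
  cpseries a z l1 -> cpseries a z l2 -> l1 = l2.
Proof. apply cseries_unique. Qed.

Lemma Re_csum (u : nat -> C) (n : nat) :
  Re (csum u n) = sum_n (fun k => Re (u k)) n.
Proof.
  induction n as [|n IH]; [now rewrite csum_0, sum_O|].
  rewrite csum_S, sum_Sn, <- IH; reflexivity.
Qed.

Lemma Im_csum (u : nat -> C) (n : nat) :
  Im (csum u n) = sum_n (fun k => Im (u k)) n.
Proof.
  induction n as [|n IH]; [now rewrite csum_0, sum_O|].
  rewrite csum_S, sum_Sn, <- IH; reflexivity.
Qed.

Lemma cseries_Re (u : nat -> C) (l : C) :
  cseries u l -> is_series (fun n => Re (u n)) (Re l).
Proof.
  intros H; unfold is_series.
  apply (filterlim_ext (fun n => Re (csum u n))).
  { intros n; apply Re_csum. }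
  apply (filterlim_comp _ _ _ (csum u) Re eventually (locally l)); [exact H|].
  destruct l; apply (continuous_fst (U := R_UniformSpace) (V := R_UniformSpace)).
Qed.

Lemma cseries_Im (u : nat -> C) (l : C) :
  cseries u l -> is_series (fun n => Im (u n)) (Im l).
Proof.
  intros H; unfold is_series.
  apply (filterlim_ext (fun n => Im (csum u n))).
  { intros n; apply Im_csum. }
  apply (filterlim_comp _ _ _ (csum u) Im eventually (locally l)); [exact H|].
  destruct l; apply (continuous_snd (U := R_UniformSpace) (V := R_UniformSpace)).
Qed.

Lemma cpseries_0 (a : nat -> C) : cpseries a (RtoC 0) (a 0%nat).
Proof.
  apply cpseries_series, cseries_eps; intros eps He; exists 0%nat; intros n _.
  replace (csum (fun k => (a k * 0 ^ k)%C) n) with (a 0%nat).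
  - replace (a 0%nat - a 0%nat)%C with (RtoC 0) by ring; now rewrite Cmod_0.
  - induction n as [|n IH]; [rewrite csum_0; simpl; ring|].
    rewrite csum_S, <- IH; simpl; ring.
Qed.

(* The coefficient sequences of power series whose radius of convergence is at
   least 1. *)
Definition tame (a : nat -> C) : Prop :=
  forall r, 0 <= r < 1 -> exists M, forall n, Cmod (a n) * r ^ n <= M.

(** A term is the difference of two partial sums, and the partial sums of a convergent series are
    bounded. *)
Lemma tame_expansion (f : C -> C) (a : nat -> C) : has_expansion f a -> tame a.
Proof.
  intros H r Hr.
  assert (Hz : in_U (RtoC r)).
  { unfold in_U; rewrite Cmod_R, Rabs_pos_eq; lra. }
  specialize (H _ Hz); apply cpseries_series in H.
  destruct (filterlim_bounded (V := C_NormedModule)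
              (csum (fun n => (a n * RtoC r ^ n)%C)) (ex_intro _ _ H)) as [M HM].
  assert (HM' : forall n, Cmod (csum (fun n => (a n * RtoC r ^ n)%C) n) <= M).
  { intros n; apply HM. }
  exists (M + M); intros n.
  replace (Cmod (a n) * r ^ n) with (Cmod (a n * RtoC r ^ n)%C)
    by (rewrite Cmod_mult, Cmod_pow, Cmod_R, Rabs_pos_eq; lra).
  destruct n as [|n].
  - generalize (HM' 0%nat); rewrite csum_0; intros H0.
    assert (0 <= M) by (eapply Rle_trans; [apply Cmod_ge_0|exact H0]); lra.
  - set (u := fun n => (a n * RtoC r ^ n)%C) in *.
    change (Cmod (u (S n)) <= M + M).
    replace (u (S n)) with (csum u (S n) + - csum u n)%C
      by (rewrite csum_S; ring).
    eapply Rle_trans; [apply Cmod_triangle|].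
    rewrite Cmod_opp; apply Rplus_le_compat; apply HM'.
Qed.

Lemma tame_mult (a b : nat -> C) :
  tame a -> tame b -> tame (fun n => (a n * b n)%C).
Proof.
  intros Ha Hb r Hr.
  (* The radius is shared out evenly: each factor absorbs [sqrt r ^ n]. *)
  assert (Hs : 0 <= sqrt r < 1).
  { split; [apply sqrt_pos|]. rewrite <- sqrt_1; apply sqrt_lt_1; lra. }
  destruct (Ha _ Hs) as [M HM]; destruct (Hb _ Hs) as [K HK].
  exists (M * K); intros n; rewrite Cmod_mult.
  replace (Cmod (a n) * Cmod (b n) * r ^ n)
    with ((Cmod (a n) * sqrt r ^ n) * (Cmod (b n) * sqrt r ^ n)).
  - apply Rmult_le_compat; try apply HM; try apply HK;
      apply Rmult_le_pos; try apply Cmod_ge_0; apply pow_le; lra.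
  - replace (r ^ n) with (sqrt r ^ n * sqrt r ^ n); [ring|].
    rewrite <- Rpow_mult_distr, sqrt_sqrt; lra.
Qed.

Lemma tame_le (a b : nat -> C) :
  tame b -> (forall n, Cmod (a n) <= Cmod (b n)) -> tame a.
Proof.
  intros Hb H r Hr; destruct (Hb r Hr) as [M HM]; exists M; intros n.
  eapply Rle_trans; [|apply (HM n)].
  apply Rmult_le_compat_r; [apply pow_le; lra|apply H].
Qed.

Lemma tame_bounded (a : nat -> C) (K : R) :
  (forall n, Cmod (a n) <= K) -> tame a.
Proof.
  intros H r Hr; exists K; intros n.
  assert (0 <= Cmod (a n)) by apply Cmod_ge_0.
  assert (0 <= r ^ n <= 1).
  { split; [apply pow_le; lra|]. rewrite <- (pow1 n); apply pow_incr; lra. }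
  specialize (H n); nra.
Qed.

Lemma tame_plus (a b : nat -> C) :
  tame a -> tame b -> tame (fun n => (a n + b n)%C).
Proof.
  intros Ha Hb r Hr; destruct (Ha r Hr) as [M HM]; destruct (Hb r Hr) as [K HK].
  exists (M + K); intros n.
  assert (0 <= r ^ n) by (apply pow_le; lra).
  generalize (Cmod_triangle (a n) (b n)) (HM n) (HK n); nra.
Qed.

(** The differentiated geometric series keeps the radius 1, so its terms [(n + 1) * r ^ n] tend to 0
    and are bounded. *)
Lemma tame_nat : tame (fun n => RtoC (INR n)).
Proof.
  intros r Hr.
  assert (Hc : Rbar_lt (Rabs r) (CV_radius (fun _ => 1))).
  { apply Rbar_lt_le_trans with (Finite 1).
    - simpl; rewrite Rabs_pos_eq; lra.
    - apply (proj1 (CV_radius_bounded (fun _ => 1))); exists 1; intros n.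
      rewrite pow1, Rmult_1_r, Rabs_R1; lra. }
  rewrite <- CV_radius_derive in Hc.
  apply CV_disk_inside in Hc.
  apply ex_series_lim_0 in Hc.
  destruct (filterlim_bounded (V := R_NormedModule)
              (fun n => Rabs (PS_derive (fun _ => 1) n * r ^ n))
              (ex_intro _ (0 : R) Hc)) as [M HM].
  exists (M + 0); intros n; rewrite Cmod_R.
  assert (H0 : 0 <= M) by (eapply Rle_trans; [apply (norm_ge_0 (V := R_NormedModule))|apply (HM 0%nat)]).
  destruct n as [|n]; [simpl; rewrite Rabs_R0; lra|].
  specialize (HM n).
  assert (HM' : Rabs (Rabs (PS_derive (fun _ => 1) n * r ^ n)) <= M) by exact HM.
  unfold PS_derive in HM'; rewrite Rabs_Rabsolu, Rmult_1_r in HM'.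
  assert (0 <= INR (S n)) by apply pos_INR.
  assert (0 <= r ^ n) by (apply pow_le; lra).
  rewrite Rabs_pos_eq in HM' by nra; rewrite Rabs_pos_eq by lra.
  change (r ^ S n) with (r * r ^ n).
  assert (0 <= INR (S n) * r ^ n) by nra.
  nra.
Qed.

(** Boundedness at a radius [s] strictly between [r] and 1 leaves the ratio [q = r / s] to spare,
    uniformly on the closed disc of radius [r]. *)
Lemma tame_geometric (a : nat -> C) (r : R) :
  tame a -> 0 <= r < 1 ->
  exists K q, 0 <= K /\ 0 <= q < 1 /\
    forall z n, Cmod z <= r -> Cmod (a n * z ^ n)%C <= K * q ^ n.
Proof.
  intros Ha Hr.
  set (s := (1 + r) / 2).
  assert (Hs : 0 <= s < 1) by (unfold s; lra).
  destruct (Ha s Hs) as [K HK].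
  exists K, (r / s); split; [|split].
  - eapply Rle_trans; [|apply (HK 0%nat)]; simpl; rewrite Rmult_1_r.
    apply Cmod_ge_0.
  - split; [apply Rdiv_le_0_compat; unfold s; lra|].
    apply Rlt_div_l; unfold s; lra.
  - intros z n Hz; rewrite Cmod_mult, Cmod_pow.
    apply Rle_trans with (Cmod (a n) * r ^ n).
    + apply Rmult_le_compat_l; [apply Cmod_ge_0|].
      apply pow_incr; split; [apply Cmod_ge_0|exact Hz].
    + replace (Cmod (a n) * r ^ n) with (Cmod (a n) * s ^ n * (r / s) ^ n).
      * apply Rmult_le_compat_r; [|apply HK].
        apply pow_le, Rdiv_le_0_compat; unfold s; lra.
      * rewrite Rmult_assoc, <- Rpow_mult_distr; do 2 f_equal; field; unfold s; lra.
Qed.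

Lemma tame_convergent (a : nat -> C) (z : C) :
  tame a -> in_U z -> exists l, cpseries a z l.
Proof.
  intros Ha Hz.
  destruct (tame_geometric a (Cmod z) Ha) as [K [q [HK [Hq H]]]].
  { split; [apply Cmod_ge_0|exact Hz]. }
  destruct (ex_series_le (V := C_CompleteNormedModule)
              (fun n => (a n * z ^ n)%C) (fun n => K * q ^ n)) as [l Hl].
  - intros n; apply H; lra.
  - apply (ex_series_scal_l (K := R_AbsRing) (V := R_NormedModule) K).
    exists (/ (1 - q)); apply is_series_geom; rewrite Rabs_pos_eq; lra.
  - exists l; apply cpseries_series; exact Hl.
Qed.

(** Multiplied by [1 - q], the geometric bound on the tail telescopes. [N] does not depend on [z],
    because one truncation will have to serve a whole circle. *)
Lemma tame_uniform_tail (a : nat -> C) (r eps : R) :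
  tame a -> 0 <= r < 1 -> 0 < eps ->
  exists N, forall n z l, (N <= n)%nat -> Cmod z <= r -> cpseries a z l ->
    Cmod (csum (fun k => (a k * z ^ k)%C) n - l) <= eps.
Proof.
  intros Ha Hr He.
  destruct (tame_geometric a r Ha Hr) as [K [q [HK [Hq H]]]].
  assert (Hcauchy : forall z n k, Cmod z <= r ->
    Cmod (csum (fun k => (a k * z ^ k)%C) n
          - csum (fun k => (a k * z ^ k)%C) (n + k)) * (1 - q)
      <= K * (q ^ S n - q ^ S (n + k))).
  { intros z n k Hz; set (u := fun k => (a k * z ^ k)%C).
    induction k as [|k IH].
    - rewrite Nat.add_0_r.
      replace (csum u n - csum u n)%C with (RtoC 0) by ring.
      rewrite Cmod_0; lra.
    - rewrite Nat.add_succ_r, csum_S.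
      replace (csum u n - (csum u (n + k) + u (S (n + k))))%C
        with ((csum u n - csum u (n + k)) + - u (S (n + k)))%C by ring.
      apply Rle_trans with
        ((Cmod (csum u n - csum u (n + k)) + K * q ^ S (n + k)) * (1 - q)).
      + apply Rmult_le_compat_r; [lra|].
        eapply Rle_trans; [apply Cmod_triangle|].
        rewrite Cmod_opp; apply Rplus_le_compat_l, H, Hz.
      + change (q ^ S (S (n + k))) with (q * q ^ S (n + k)); lra. }
  assert (Hlim : is_lim_seq (fun n => q ^ n) 0).
  { apply is_lim_seq_geom; rewrite Rabs_pos_eq; lra. }
  apply is_lim_seq_spec in Hlim.
  (* [K + 1] rather than [K] guards against [K = 0]. *)
  assert (Hd : 0 < eps * (1 - q) / (2 * (K + 1))).
  { apply Rdiv_lt_0_compat; nra. }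
  destruct (Hlim (mkposreal _ Hd)) as [N HN]; simpl in HN.
  exists N; intros n z l Hn Hz Hl.
  apply cpseries_series in Hl; set (u := fun k => (a k * z ^ k)%C) in *.
  assert (Hu : cseries u l) by exact Hl.
  rewrite cseries_eps in Hu.
  destruct (Hu (eps / 2)) as [N' HN']; [lra|].
  specialize (HN' (n + N')%nat ltac:(lia)).
  specialize (Hcauchy z n N' Hz); fold u in Hcauchy.
  specialize (HN (S n) ltac:(lia)).
  assert (0 <= q ^ S n) by (apply pow_le; lra).
  assert (0 <= q ^ S (n + N')) by (apply pow_le; lra).
  rewrite Rminus_0_r, Rabs_pos_eq in HN by assumption.
  apply Rlt_div_r in HN; [|lra].
  assert (Cmod (csum u n - csum u (n + N')) <= eps / 2).
  { apply Rmult_le_reg_r with (1 - q); [lra|]. nra. }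
  replace (csum u n - l)%C
    with ((csum u n - csum u (n + N')) + (csum u (n + N') - l))%C by ring.
  eapply Rle_trans; [apply Cmod_triangle|]; lra.
Qed.

Lemma tame_CV_radius (a : nat -> C) (x : nat -> R) :
  tame a -> (forall n, Rabs (x n) <= Cmod (a n)) ->
  Rbar_le 1 (CV_radius x).
Proof.
  intros Ha Hx.
  assert (H : forall r, 0 <= r < 1 -> Rbar_le r (CV_radius x)).
  { intros r Hr; apply (proj1 (CV_radius_bounded x)).
    destruct (Ha r Hr) as [M HM]; exists M; intros n.
    rewrite Rabs_mult, (Rabs_pos_eq (r ^ n)) by (apply pow_le; lra).
    eapply Rle_trans; [|apply HM]; apply Rmult_le_compat_r; [apply pow_le; lra|].
    apply Hx. }
  generalize (H 0 ltac:(lra)).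
  destruct (CV_radius x) as [c| |]; simpl in *; try tauto.
  intros Hc; apply Rnot_lt_le; intros Hlt.
  specialize (H ((1 + c) / 2) ltac:(lra)); lra.
Qed.

(** On the real axis the real and imaginary parts of the coefficients are coefficients of real power
    series, which are determined by their sums near 0. This is what allows the description in [coef]
    to be evaluated. *)
Lemma expansion_unique (f : C -> C) (a b : nat -> C) :
  has_expansion f a -> has_expansion f b -> forall n, a n = b n.
Proof.
  intros Ha Hb n.
  assert (Hin : forall x : R, Rabs x < 1 -> in_U (RtoC x)).
  { intros x Hx; unfold in_U; now rewrite Cmod_R. }
  assert (Hpow : forall (c : nat -> C) (x : R) k,
    Re (c k * RtoC x ^ k)%C = Re (c k) * x ^ k
    /\ Im (c k * RtoC x ^ k)%C = Im (c k) * x ^ k).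
  { intros c x k; rewrite <- RtoC_pow; destruct (c k); split; simpl; ring. }
  assert (HRe : forall (c : nat -> C), has_expansion f c -> forall x, Rabs x < 1 ->
    PSeries (fun k => Re (c k)) x = Re (f (RtoC x))
    /\ PSeries (fun k => Im (c k)) x = Im (f (RtoC x))).
  { intros c Hc x Hx; specialize (Hc _ (Hin x Hx)); apply cpseries_series in Hc.
    split; apply is_series_unique.
    - apply cseries_Re in Hc; revert Hc; apply is_series_ext; intros k.
      apply Hpow.
    - apply cseries_Im in Hc; revert Hc; apply is_series_ext; intros k.
      apply Hpow. }
  assert (Hrad : forall (c : nat -> C), has_expansion f c ->
    Rbar_lt 0 (CV_radius (fun k => Re (c k)))
    /\ Rbar_lt 0 (CV_radius (fun k => Im (c k)))).
  { intros c Hc; apply tame_expansion in Hc.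
    split; (apply Rbar_lt_le_trans with (Finite 1); [simpl; lra|]);
      apply (tame_CV_radius c _ Hc); intros k;
      [apply re_le_Cmod|].
    exact (Rle_trans _ _ _ (Rmax_r _ _) (Rmax_Cmod (c k))). }
  assert (Hloc : locally 0 (fun x : R_UniformSpace => Rabs x < 1)).
  { exists (mkposreal 1 Rlt_0_1); intros y Hy.
    unfold ball in Hy; simpl in Hy; unfold AbsRing_ball, abs, minus, plus, opp in Hy.
    simpl in Hy; rewrite Ropp_0, Rplus_0_r in Hy; exact Hy. }
  apply injective_projections.
  - apply (PSeries_ext_recip (fun k => Re (a k)) (fun k => Re (b k)));
      try (apply Hrad; assumption).
    revert Hloc; apply filter_imp; intros x Hx.
    rewrite (proj1 (HRe a Ha x Hx)), (proj1 (HRe b Hb x Hx)); reflexivity.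
  - apply (PSeries_ext_recip (fun k => Im (a k)) (fun k => Im (b k)));
      try (apply Hrad; assumption).
    revert Hloc; apply filter_imp; intros x Hx.
    rewrite (proj2 (HRe a Ha x Hx)), (proj2 (HRe b Hb x Hx)); reflexivity.
Qed.

Lemma coef_expansion (f : C -> C) (a : nat -> C) (k : nat) :
  has_expansion f a -> coef f k = a k.
Proof.
  intros Ha; apply (iota_unique (V := C_CompleteNormedModule)).
  - intros y [b [Hb ->]]; apply (expansion_unique f); assumption.
  - exists a; split; [exact Ha|reflexivity].
Qed.

Lemma CPSeries_unique (a : nat -> C) (z l : C) :
  cpseries a z l -> CPSeries a z = l.
Proof.
  intros Hl; apply (iota_unique (V := C_CompleteNormedModule)); [|exact Hl].
  intros y Hy; apply (cpseries_unique a z); assumption.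
Qed.

Lemma CPSeries_expansion (a : nat -> C) : tame a -> has_expansion (CPSeries a) a.
Proof.
  intros Ha z Hz; destruct (tame_convergent a z Ha Hz) as [l Hl].
  rewrite (CPSeries_unique a z l Hl); exact Hl.
Qed.

(** * Convolution with a Caratheodory function *)

Lemma csum_ext (u v : nat -> C) (n : nat) :
  (forall k, (k <= n)%nat -> u k = v k) -> csum u n = csum v n.
Proof. exact (sum_n_ext_loc u v n). Qed.

Lemma csum_mult_l (c : C) (u : nat -> C) (n : nat) :
  csum (fun k => (c * u k)%C) n = (c * csum u n)%C.
Proof. exact (sum_n_mult_l (K := C_Ring) c u n). Qed.

Lemma csum_plus (u v : nat -> C) (n : nat) :
  csum (fun k => (u k + v k)%C) n = (csum u n + csum v n)%C.
Proof. exact (sum_n_plus u v n). Qed.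

Lemma csum_switch (u : nat -> nat -> C) (m n : nat) :
  csum (fun i => csum (u i) n) m = csum (fun j => csum (fun i => u i j) m) n.
Proof. exact (sum_n_switch u m n). Qed.

Lemma Re_csum_ge_0 (u : nat -> C) (n : nat) :
  (forall k, 0 <= Re (u k)) -> 0 <= Re (csum u n).
Proof.
  intros H; induction n as [|n IH]; [rewrite csum_0; apply H|].
  rewrite csum_S, re_plus; specialize (H (S n)); lra.
Qed.

Lemma csum_zero (u : nat -> C) (n : nat) :
  (forall k, (k <= n)%nat -> u k = RtoC 0) -> csum u n = RtoC 0.
Proof.
  induction n as [|n IH]; intros H.
  - rewrite csum_0; apply H; lia.
  - rewrite csum_S, IH, (H (S n)); [ring|lia|intros; apply H; lia].
Qed.

Lemma csum_single (u : nat -> C) (i n : nat) :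
  (i <= n)%nat -> (forall k, (k <= n)%nat -> k <> i -> u k = RtoC 0) ->
  csum u n = u i.
Proof.
  induction n as [|n IH]; intros Hi H.
  - rewrite csum_0; f_equal; lia.
  - rewrite csum_S; destruct (Nat.eq_dec i (S n)) as [->|Hne].
    + rewrite csum_zero; [ring|]; intros k Hk; apply H; lia.
    + rewrite IH, (H (S n)); [ring|lia|lia|lia|]; intros k Hk; apply H; lia.
Qed.

(** Serves the two places where a constant term alone is replaced: the slack in [convolution_Re_ge],
    and [unit_head]. *)
Lemma csum_head (u : nat -> C) (x : C) (n : nat) :
  csum (fun k => match k with O => x | S _ => u k end) n
  = (csum u n - u O + x)%C.
Proof.
  induction n as [|n IH]; [rewrite !csum_0; ring|].
  rewrite !csum_S, IH; ring.
Qed.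

(** * Orthogonality of roots of unity and positivity of coefficient products *)

Lemma csum_root_of_unity (q : C) (n : nat) :
  (q ^ S n)%C = RtoC 1 -> q <> RtoC 1 -> csum (fun k => (q ^ k)%C) n = RtoC 0.
Proof.
  intros Hq Hne.
  assert (E : forall m, ((q - 1) * csum (fun k => (q ^ k)%C) m = q ^ S m - 1)%C).
  { induction m as [|m IH]; [rewrite csum_0; simpl; ring|].
    rewrite csum_S, Cmult_plus_distr_l, IH; simpl; ring. }
  specialize (E n); rewrite Hq in E.
  replace (RtoC 1 - RtoC 1)%C with (RtoC 0) in E by ring.
  destruct (Ceq_dec (csum (fun k => (q ^ k)%C) n) (RtoC 0)) as [H0|H0]; [exact H0|].
  exfalso; revert E; apply Cmult_neq_0; [|exact H0].
  intros E; apply Hne; replace q with (q - 1 + 1)%C by ring; rewrite E; ring.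
Qed.

Lemma csum_one (n : nat) : csum (fun k => (1 ^ k)%C) n = RtoC (INR (S n)).
Proof.
  induction n as [|n IH]; [rewrite csum_0; reflexivity|].
  rewrite csum_S, IH, Cpow_1_l, (S_INR (S n)), RtoC_plus; reflexivity.
Qed.

Definition cis (x : R) : C := (cos x, sin x).

Lemma cis_pow (x : R) (n : nat) : (cis x ^ n)%C = cis (INR n * x).
Proof.
  induction n as [|n IH].
  - unfold cis; simpl; rewrite Rmult_0_l, cos_0, sin_0; reflexivity.
  - rewrite Cpow_S, IH, S_INR; unfold cis.
    replace ((INR n + 1) * x) with (x + INR n * x) by ring.
    rewrite cos_plus, sin_plus; unfold Cmult; simpl; f_equal; ring.
Qed.

Lemma cis_ne_1 (x : R) : 0 < x < 2 * PI -> cis x <> RtoC 1.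
Proof.
  intros Hx E; injection E; intros _ Hc.
  assert (H : 0 < sin (x / 2)) by (apply sin_gt_0; lra).
  replace x with (2 * (x / 2)) in Hc by field.
  rewrite cos_2a_sin in Hc; nra.
Qed.

Lemma primitive_root (n : nat) :
  exists w, (w * Cconj w)%C = RtoC 1 /\ (w ^ S n)%C = RtoC 1
    /\ forall j, (0 < j <= n)%nat -> (w ^ j)%C <> RtoC 1.
Proof.
  assert (Hn : 0 < INR (S n)) by (apply lt_0_INR; lia).
  exists (cis (2 * PI / INR (S n))); split; [|split].
  - generalize (sin2_cos2 (2 * PI / INR (S n))); unfold Rsqr.
    unfold cis, Cconj, Cmult; cbn [fst snd]; intros E; unfold RtoC.
    f_equal; [rewrite <- E|]; ring.
  - rewrite cis_pow; replace (INR (S n) * _) with (2 * PI) by (field; lra).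
    unfold cis; rewrite cos_2PI, sin_2PI; reflexivity.
  - intros j Hj; rewrite cis_pow; apply cis_ne_1.
    assert (0 < INR j) by (apply lt_0_INR; lia).
    assert (INR j < INR (S n)) by (apply lt_INR; lia).
    generalize PI_RGT_0; intros HPI.
    replace (INR j * (2 * PI / INR (S n))) with (2 * PI * (INR j / INR (S n)))
      by (field; lra).
    assert (0 < INR j / INR (S n) < 1).
    { split; [apply Rdiv_lt_0_compat; lra|apply Rlt_div_l; lra]. }
    split; nra.
Qed.

Lemma csum_product (x y a b : nat -> C) (m n : nat) :
  csum (fun k => (csum (fun i => a i * x i ^ k) m
                  * csum (fun j => b j * y j ^ k) m)%C) n
  = csum (fun i => csum (fun j =>
      (a i * b j * csum (fun k => (x i * y j) ^ k) n)%C) m) m.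
Proof.
  transitivity (csum (fun k => csum (fun i => csum (fun j =>
    (a i * b j * (x i * y j) ^ k)%C) m) m) n).
  - apply csum_ext; intros k _; rewrite Cmult_comm, <- csum_mult_l.
    apply csum_ext; intros i _; rewrite Cmult_comm, <- csum_mult_l.
    apply csum_ext; intros j _; rewrite Cpow_mult_l; ring.
  - rewrite csum_switch; apply csum_ext; intros i _.
    rewrite csum_switch; apply csum_ext; intros j _.
    apply csum_mult_l.
Qed.

Lemma Cpow_comm (z : C) (i j : nat) : ((z ^ i) ^ j = (z ^ j) ^ i)%C.
Proof. now rewrite <- !Cpow_mult_r, Nat.mul_comm. Qed.

(* With [N > 2m], averaging over the N-th roots of unity [w] the products
   [2 Re A(w) Re B(1/w) = Re (A(w) B(1/w)) + Re (conj (A(w)) B(1/w))]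
   isolates exactly the coefficients below. *)
Lemma Re_coefficient_product (a b : nat -> C) (m : nat) :
  (forall z, Cmod z = 1 -> 0 <= Re (csum (fun k => (a k * z ^ k)%C) m)) ->
  (forall z, Cmod z = 1 -> 0 <= Re (csum (fun k => (b k * z ^ k)%C) m)) ->
  0 <= Re (csum (fun k => (a k * b k)%C) m + Cconj (a O) * b O)%C.
Proof.
  intros Ha Hb.
  (* The roots have order [2 * m + 1]. In [S1] the exponents are differences, in [S2] sums
     [i + j <= 2 * m]; both stay below the order, so only exponent 0 survives the averaging. *)
  set (n := (2 * m)%nat).
  destruct (primitive_root n) as [w [Hww [Hwn Hw]]].
  set (v := Cconj w) in *.
  assert (Hv : forall j, (v ^ j)%C = Cconj (w ^ j)%C).
  { intros j; symmetry; apply Cpow_conj. }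
  assert (Hconj1 : Cconj (RtoC 1) = RtoC 1).
  { unfold Cconj, RtoC; simpl; f_equal; ring. }
  assert (Hvn : (v ^ S n)%C = RtoC 1) by now rewrite Hv, Hwn.
  assert (Hv1 : forall j, (0 < j <= n)%nat -> (v ^ j)%C <> RtoC 1).
  { intros j Hj E; apply (Hw j Hj); rewrite Hv in E.
    rewrite <- (Cconj_conj (w ^ j)), E; exact Hconj1. }
  assert (Hvw : forall j, (w ^ j * v ^ j)%C = RtoC 1).
  { intros j; now rewrite <- Cpow_mult_l, Hww, Cpow_1_l. }
  assert (Hsub : forall x j, (x ^ S n)%C = RtoC 1 -> ((x ^ j) ^ S n)%C = RtoC 1).
  { intros x j Hx; now rewrite Cpow_comm, Hx, Cpow_1_l. }
  set (A := fun k => csum (fun i => (a i * (w ^ i) ^ k)%C) m).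
  set (A' := fun k => csum (fun i => (Cconj (a i) * (v ^ i) ^ k)%C) m).
  set (B := fun k => csum (fun j => (b j * (v ^ j) ^ k)%C) m).
  assert (HA' : forall k, A' k = Cconj (A k)).
  { intros k; unfold A, A'; clear; induction m as [|m' IH].
    - rewrite !csum_0, Cmult_conj, !Cpow_conj; reflexivity.
    - rewrite !csum_S, IH, Cplus_conj, Cmult_conj, !Cpow_conj.
      reflexivity. }
  assert (HmodW : Cmod w = 1).
  { assert (Hm : Cmod w * Cmod w = 1).
    { rewrite <- (Cmod_conj w) at 2; rewrite <- Cmod_mult.
      unfold v in Hww; rewrite Hww; apply Cmod_1. }
    generalize (Cmod_ge_0 w); nra. }
  assert (HmodV : Cmod v = 1) by (unfold v; now rewrite Cmod_conj).
  assert (HA : forall k, 0 <= Re (A k)).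
  { intros k; replace (A k) with (csum (fun i => (a i * (w ^ k) ^ i)%C) m).
    - apply Ha; rewrite Cmod_pow, HmodW; apply pow1.
    - apply csum_ext; intros i _; now rewrite Cpow_comm. }
  assert (HB : forall k, 0 <= Re (B k)).
  { intros k; replace (B k) with (csum (fun i => (b i * (v ^ k) ^ i)%C) m).
    - apply Hb; rewrite Cmod_pow, HmodV; apply pow1.
    - apply csum_ext; intros i _; now rewrite Cpow_comm. }
  assert (S1 : csum (fun k => (A k * B k)%C) n
               = (RtoC (INR (S n)) * csum (fun k => (a k * b k)%C) m)%C).
  { unfold A, B; rewrite csum_product, <- csum_mult_l.
    apply csum_ext; intros i Hi.
    rewrite (csum_single _ i); [|exact Hi|].
    - rewrite Hvw, csum_one; ring.
    - intros j Hj Hne; rewrite csum_root_of_unity; [ring| |].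
      + rewrite Cpow_mult_l, (Hsub w), (Hsub v) by assumption; ring.
      + destruct (Nat.lt_total i j) as [Hlt|[->|Hlt]]; [| tauto |].
        * replace j with (i + (j - i))%nat by lia.
          rewrite Cpow_add_r, Cmult_assoc, Hvw, Cmult_1_l.
          apply Hv1; unfold n; lia.
        * replace i with (j + (i - j))%nat at 1 by lia.
          rewrite Cpow_add_r, (Cmult_comm (w ^ j)), <- Cmult_assoc, Hvw, Cmult_1_r.
          apply Hw; unfold n; lia. }
  assert (S2 : csum (fun k => (A' k * B k)%C) n
               = (RtoC (INR (S n)) * (Cconj (a O) * b O))%C).
  { unfold A', B; rewrite csum_product.
    assert (Hz : forall i j, (i <= m)%nat -> (j <= m)%nat -> (0 < i + j)%nat ->
      csum (fun k => ((v ^ i * v ^ j) ^ k)%C) n = RtoC 0).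
    { intros i j Hi Hj Hij; rewrite <- Cpow_add_r.
      apply csum_root_of_unity; [now apply Hsub|apply Hv1; unfold n; lia]. }
    rewrite (csum_single _ 0%nat); [|lia|].
    - rewrite (csum_single _ 0%nat); [|lia|].
      + rewrite <- Cpow_add_r; change (v ^ (0 + 0))%C with (RtoC 1).
        rewrite csum_one; ring.
      + intros j Hj Hne; rewrite Hz by lia; ring.
    - intros i Hi Hne; apply csum_zero; intros j Hj; rewrite Hz by lia; ring. }
  assert (Hn : 0 < INR (S n)) by (apply lt_0_INR; lia).
  assert (Hsum : 0 <= Re (csum (fun k => (A k * B k + A' k * B k)%C) n)).
  { apply Re_csum_ge_0; intros k; rewrite HA'.
    generalize (HA k) (HB k); destruct (A k), (B k); simpl; nra. }
  rewrite csum_plus, S1, S2, <- Cmult_plus_distr_l in Hsum.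
  rewrite re_scal_l in Hsum; nra.
Qed.

(** Averaging [h] against the density [Re p] yields half of the convolution, except that the
    constant term enters in full: the average is [(l + h O) / 2], and it inherits the bound [c]. *)
Lemma convolution_Re_ge (p h : nat -> C) (r c : R) :
  tame p -> tame h -> p O = RtoC 1 -> r <= 1 ->
  (forall z l, in_U z -> cpseries p z l -> 0 <= Re l) ->
  (forall z l, Cmod z < r -> cpseries h z l -> c <= Re l) ->
  forall z l, Cmod z < r -> cpseries (fun n => (p n * h n)%C) z l ->
    2 * c <= Re l + Re (h O).
Proof.
  intros Tp Th Hp0 Hr Hp Hh z l Hz Hl.
  assert (Hz0 := Cmod_ge_0 z).
  (* Splits [z = s * y] with [s < 1] and [Cmod y < r], so that [p] on the circle of radius [s] and
     [h] on that of radius [Cmod y] are both within reach of the hypotheses. *)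
  set (s := (1 + Cmod z / r) / 2).
  assert (Hzr : 0 <= Cmod z / r < 1).
  { split; [apply Rdiv_le_0_compat; lra|apply Rlt_div_l; lra]. }
  assert (Hs : 0 < s < 1) by (unfold s; lra).
  assert (Hs0 : RtoC s <> RtoC 0) by (intros E; apply RtoC_inj in E; lra).
  set (y := (z / RtoC s)%C).
  assert (Hy : Cmod y < r).
  { unfold y; rewrite Cmod_div, Cmod_R, Rabs_pos_eq by (assumption || lra).
    apply Rlt_div_l; [lra|].
    assert (E : Cmod z = r * (Cmod z / r)) by (field; lra).
    rewrite E at 1; apply Rmult_lt_compat_l; unfold s; lra. }
  assert (key : forall eps, 0 < eps < 1 ->
    0 <= Re l + eps + Re (h O) - 2 * c + 2 * eps
         + eps * (2 * (Re (h O) - c) + 2 * eps)).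
  { intros eps He.
    destruct (tame_uniform_tail p s eps Tp) as [N1 H1]; [lra|lra|].
    destruct (tame_uniform_tail h (Cmod y) eps Th) as [N2 H2];
      [split; [apply Cmod_ge_0|lra]|lra|].
    destruct (tame_uniform_tail _ (Cmod z) eps (tame_mult p h Tp Th)) as [N3 H3];
      [lra|lra|].
    set (m := (N1 + N2 + N3)%nat).
    specialize (H3 m z l ltac:(lia) (Rle_refl _) Hl).
    (* The added [eps] makes up for the truncation error in the real part; subtracting [c] in [b]
       makes the second factor nonnegative as well. *)
    set (a := fun k => match k with
                       | O => (p O + RtoC eps)%C
                       | S _ => (p k * RtoC s ^ k)%C end).
    set (b := fun k => match k with
                       | O => (h O + RtoC (eps - c))%C
                       | S _ => (h k * y ^ k)%C end).
    assert (Hab := Re_coefficient_product a b m).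
    assert (Hcl : forall x t : C, Cmod (x - t) <= eps -> Re t - eps <= Re x <= Re t + eps).
    { intros x t H; generalize (re_le_Cmod (x - t)%C); intros H'.
      assert (H'' : Rabs (Re (x - t)) <= eps) by lra.
      apply Rabs_le_between in H''; destruct x, t; simpl in *; lra. }
    cut (0 <= Re (csum (fun k => (a k * b k)%C) m + Cconj (a O) * b O)%C).
    - intros H.
      replace (csum (fun k => (a k * b k)%C) m)
        with (csum (fun k => (p k * h k * z ^ k)%C) m - h O
              + (1 + RtoC eps) * (h O + RtoC (eps - c)))%C in H.
      + apply Hcl in H3; unfold a, b in H; rewrite Hp0 in H; clear - H H3 He.
        destruct (h O) as [h1 h2].
        destruct (csum _ m) as [t1 t2]; destruct l as [l1 l2].
        simpl in *; nra.
      + transitivity (csum (fun k => match k with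
          | O => ((1 + RtoC eps) * (h O + RtoC (eps - c)))%C
          | S _ => (p k * h k * z ^ k)%C end) m).
        * rewrite csum_head, Hp0; simpl; ring.
        * apply csum_ext; intros [|k] _; unfold a, b; [now rewrite Hp0|].
          replace (z ^ S k)%C with (RtoC s ^ S k * y ^ S k)%C; [ring|].
          rewrite <- Cpow_mult_l; f_equal; unfold y; field; exact Hs0.
    - apply Hab; intros x Hx.
      + assert (Hsx : Cmod (RtoC s * x)%C = s).
        { rewrite Cmod_mult, Cmod_R, Hx, Rabs_pos_eq; lra. }
        assert (HU : in_U (RtoC s * x)%C) by (unfold in_U; lra).
        destruct (tame_convergent p _ Tp HU) as [t Ht].
        specialize (Hp _ _ HU Ht).
        specialize (H1 m (RtoC s * x)%C t ltac:(lia) ltac:(rewrite Hsx; lra) Ht).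
        apply Hcl in H1.
        replace (csum (fun k => (a k * x ^ k)%C) m)
          with (csum (fun k => (p k * (RtoC s * x) ^ k)%C) m + RtoC eps)%C.
        * rewrite re_plus; change (Re (RtoC eps)) with eps; lra.
        * transitivity (csum (fun k => match k with
            | O => (p O + RtoC eps)%C
            | S _ => (p k * (RtoC s * x) ^ k)%C end) m).
          -- rewrite csum_head; simpl; ring.
          -- apply csum_ext; intros [|k] _; unfold a; [simpl; ring|].
             rewrite Cpow_mult_l; ring.
      + assert (Hyx : Cmod (y * x)%C = Cmod y).
        { rewrite Cmod_mult, Hx; ring. }
        assert (HU : in_U (y * x)%C) by (unfold in_U; lra).
        destruct (tame_convergent h _ Th HU) as [t Ht].
        specialize (Hh (y * x)%C t ltac:(lra) Ht).
        specialize (H2 m (y * x)%C t ltac:(lia) ltac:(lra) Ht).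
        apply Hcl in H2.
        replace (csum (fun k => (b k * x ^ k)%C) m)
          with (csum (fun k => (h k * (y * x) ^ k)%C) m + RtoC (eps - c))%C.
        * rewrite re_plus; change (Re (RtoC (eps - c))) with (eps - c); lra.
        * transitivity (csum (fun k => match k with
            | O => (h O + RtoC (eps - c))%C
            | S _ => (h k * (y * x) ^ k)%C end) m).
          -- rewrite csum_head; simpl; ring.
          -- apply csum_ext; intros [|k] _; unfold b; [simpl; ring|].
             rewrite Cpow_mult_l; ring. }
  apply Rnot_lt_le; intros Hlt.
  set (D := 2 * c - (Re l + Re (h O))) in *.
  set (E := Rabs (2 * (Re (h O) - c))).
  assert (HE : 0 <= E) by apply Rabs_pos.
  assert (HE' : 2 * (Re (h O) - c) <= E) by apply Rle_abs.
  assert (HD : 0 < D) by (unfold D; lra).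
  (* As [eps < 1], the error terms in [key] amount to at most [eps * (E + 5)], which is less than
     the supposed deficit [D]. *)
  set (eps := D / (E + 6 + D)).
  assert (Heq : eps * (E + 6 + D) = D) by (unfold eps; field; lra).
  assert (0 < eps) by (unfold eps; apply Rdiv_lt_0_compat; lra).
  assert (eps < 1) by (unfold eps; apply Rlt_div_l; lra).
  specialize (key eps ltac:(lra)); unfold D in *; nra.
Qed.

(** * The moment series and its Pfaff transform *)

Lemma one_minus_neq_0 (z : C) : in_U z -> (1 - z)%C <> RtoC 0.
Proof.
  intros Hz E; assert (E' : z = RtoC 1)
    by (replace z with (1 - (1 - z))%C by ring; rewrite E; ring).
  unfold in_U in Hz; rewrite E', Cmod_1 in Hz; lra.
Qed.

Lemma cpseries_geometric (z : C) :
  in_U z -> cpseries (fun _ => RtoC 1) z (/ (1 - z))%C.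
Proof.
  intros Hz.
  assert (Hne := one_minus_neq_0 z Hz).
  apply cpseries_series, cseries_eps; intros eps He.
  assert (Hm : 0 < Cmod (1 - z)) by now apply Cmod_gt_0.
  assert (Hlim : is_lim_seq (fun n => Cmod z ^ n) 0).
  { apply is_lim_seq_geom; rewrite Rabs_pos_eq; [exact Hz|apply Cmod_ge_0]. }
  apply is_lim_seq_spec in Hlim.
  assert (Hd : 0 < eps * Cmod (1 - z)) by nra.
  destruct (Hlim (mkposreal _ Hd)) as [N HN]; simpl in HN.
  exists N; intros n Hn.
  replace (csum (fun k => (1 * z ^ k)%C) n - / (1 - z))%C
    with (- z ^ S n / (1 - z))%C.
  - rewrite Cmod_div, Cmod_opp, Cmod_pow by exact Hne.
    apply Rlt_div_l; [exact Hm|].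
    eapply Rle_lt_trans; [|apply (HN (S n)); lia].
    rewrite Rminus_0_r; apply Rle_abs.
  - clear Hn; induction n as [|n IH].
    + rewrite csum_0; simpl; field; exact Hne.
    + rewrite csum_S.
      replace (csum (fun k => (1 * z ^ k)%C) n + 1 * z ^ S n - / (1 - z))%C
        with (csum (fun k => (1 * z ^ k)%C) n - / (1 - z) + z ^ S n)%C by ring.
      rewrite <- IH; simpl; field; exact Hne.
Qed.

Lemma CV_radius_bounded_ge_1 (a : nat -> R) :
  (forall n, Rabs (a n) <= 1) -> forall x, Rabs x < 1 ->
  Rbar_lt (Rabs x) (CV_radius a).
Proof.
  intros Ha x Hx; apply Rbar_lt_le_trans with (Finite 1); [exact Hx|].
  apply (proj1 (CV_radius_bounded a)); exists 1; intros n.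
  rewrite pow1, Rmult_1_r; apply Ha.
Qed.

Lemma PSeries_ge_0 (a : nat -> R) (x : R) :
  (forall n, 0 <= a n) -> 0 <= x -> Rbar_lt (Rabs x) (CV_radius a) ->
  0 <= PSeries a x.
Proof.
  intros Ha Hx Hr; unfold PSeries.
  replace 0 with (Series (fun n => 0 * (a n * x ^ n)))
    by (rewrite Series_scal_l; ring).
  apply Series_le.
  - intros n; assert (0 <= a n * x ^ n)
      by (apply Rmult_le_pos; [apply Ha|now apply pow_le]); lra.
  - apply CV_radius_inside in Hr; now apply ex_pseries_R in Hr.
Qed.

(* At a negative minimum [t > 0] the hypothesis forces [0 < y' t], so [y] would
   be smaller just to the left of [t]. *)
Lemma ode_nonneg (g : R) (y dy : R -> R) :
  0 < g ->
  (forall t, 0 <= t < 1 -> is_derive y t (dy t)) ->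
  (forall t, 0 <= t < 1 -> 0 <= t * dy t + g * y t) ->
  forall t, 0 <= t < 1 -> 0 <= y t.
Proof.
  intros Hg Hd Hode t Ht; apply Rnot_lt_le; intros Hneg.
  destruct (continuity_ab_min y 0 t) as [u [Hmin Hu]]; [lra| |].
  { intros c Hc; apply continuity_pt_filterlim.
    apply (ex_derive_continuous (V := R_NormedModule)); exists (dy c).
    apply Hd; lra. }
  assert (Hyu : y u < 0) by (generalize (Hmin t ltac:(lra)); lra).
  assert (Hu1 : 0 <= u < 1) by lra.
  specialize (Hode u Hu1); specialize (Hd u Hu1).
  (* At 0 the differential inequality degenerates to [0 <= g * y 0], which supplies the initial
     sign. *)
  assert (Hu0 : 0 < u).
  { destruct (Req_dec u 0) as [E|E]; [|lra]. rewrite E in *; nra. }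
  assert (Hdy : 0 < dy u) by nra.
  apply is_derive_Reals in Hd.
  destruct (Hd (dy u / 2)) as [[delta Hdelta] Hh]; [lra|]; simpl in Hh.
  set (h := Rmin (delta / 2) u).
  assert (Hh1 : 0 < h) by (unfold h; apply Rmin_glb_lt; lra).
  assert (Hh2 : h <= delta / 2) by apply Rmin_l.
  assert (Hh3 : h <= u) by apply Rmin_r.
  specialize (Hh (- h) ltac:(lra)).
  rewrite Rabs_Ropp, Rabs_pos_eq in Hh by lra; specialize (Hh ltac:(lra)).
  apply Rabs_lt_between in Hh.
  specialize (Hmin (u + - h) ltac:(lra)).
  assert (E : (y (u + - h) - y u) / - h * h = - (y (u + - h) - y u))
    by (field; lra).
  nra.
Qed.

(** The [n]-th moment of the probability density [g * s ^ (g - 1)] on the interval from 0 to 1. *)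
Definition moment (g : R) (n : nat) : R := g / (g + INR n).

Lemma moment_bounds (g : R) (n : nat) : 0 < g -> 0 < moment g n <= 1.
Proof.
  intros Hg; generalize (pos_INR n); intros Hn; unfold moment; split.
  - apply Rdiv_lt_0_compat; lra.
  - apply Rle_div_l; lra.
Qed.

(** The operator [t d/dt + g] multiplies the coefficient of index [n] by [n + g], which cancels the
    denominator of [moment g n]. The sequence [c] is left general so that it can be [Re (z ^ n)]
    along any ray. *)
Lemma moment_PSeries_ode (g : R) (c : nat -> R) (t : R) :
  0 < g -> (forall n, Rabs (c n) <= 1) -> Rabs t < 1 ->
  let X := PSeries (fun n => moment g n * c n) in
  is_derive X t (PSeries (PS_derive (fun n => moment g n * c n)) t)
  /\ t * PSeries (PS_derive (fun n => moment g n * c n)) t + g * X t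
     = g * PSeries c t.
Proof.
  intros Hg Hc Ht X; set (a := fun n => moment g n * c n) in *.
  assert (Ha : forall n, Rabs (a n) <= 1).
  { intros n; unfold a; rewrite Rabs_mult.
    generalize (moment_bounds g n Hg) (Hc n) (Rabs_pos (c n)); intros H1 H2 H3.
    rewrite (Rabs_pos_eq (moment g n)) by lra; nra. }
  assert (Hra := CV_radius_bounded_ge_1 a Ha t Ht).
  split; [apply is_derive_PSeries; exact Hra|].
  assert (Hd : ex_pseries (PS_derive a) t)
    by (apply CV_radius_inside; now rewrite CV_radius_derive).
  rewrite <- PSeries_incr_1; unfold X; rewrite <- !PSeries_scal, <- PSeries_plus.
  - apply PSeries_ext; intros n.
    unfold PS_plus, PS_scal, PS_incr_1, PS_derive, plus, scal, a, moment.
    destruct n as [|n]; simpl plus; simpl scal; unfold mult; cbn -[INR].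
    + simpl; field; lra.
    + generalize (pos_INR (S n)); intros Hn; field; lra.
  - apply ex_pseries_incr_1, Hd.
  - apply ex_pseries_scal; [apply Rmult_comm|apply CV_radius_inside, Hra].
Qed.

(** * The hypergeometric factor: first-order equation and monotonicity *)

Definition hyp_coef (g : R) (n : nat) : R :=
  pochhammer 1 n * pochhammer 1 n / (pochhammer (g + 1) n * INR (fact n)).

Lemma pochhammer_pos (a : R) (n : nat) : 0 < a -> 0 < pochhammer a n.
Proof.
  intros Ha; induction n as [|n IH]; simpl; [lra|].
  apply Rmult_lt_0_compat; [exact IH|generalize (pos_INR n); lra].
Qed.

Lemma hyp_coef_S (g : R) (n : nat) :
  0 < g -> (g + 1 + INR n) * hyp_coef g (S n) = (INR n + 1) * hyp_coef g n.
Proof.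
  intros Hg; unfold hyp_coef; cbn [pochhammer].
  rewrite fact_simpl, mult_INR, S_INR.
  assert (0 < pochhammer (g + 1) n) by (apply pochhammer_pos; lra).
  assert (0 < INR (fact n)) by apply INR_fact_lt_0.
  generalize (pos_INR n); intros Hn; field; repeat split; lra.
Qed.

Lemma hyp_coef_bounds (g : R) (n : nat) : 0 < g -> 0 < hyp_coef g n <= 1.
Proof.
  intros Hg; induction n as [|n IH].
  - unfold hyp_coef; simpl; lra.
  - generalize (hyp_coef_S g n Hg) (pos_INR n); intros E Hn.
    assert (hyp_coef g (S n) = (INR n + 1) / (g + 1 + INR n) * hyp_coef g n)
      as ->.
    { apply Rmult_eq_reg_l with (g + 1 + INR n); [|lra].
      rewrite E; field; lra. }
    assert (0 < (INR n + 1) / (g + 1 + INR n) <= 1).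
    { split; [apply Rdiv_lt_0_compat; lra|apply Rle_div_l; lra]. }
    nra.
Qed.

Lemma hyp_coef_radius (g x : R) :
  0 < g -> Rabs x < 1 -> Rbar_lt (Rabs x) (CV_radius (hyp_coef g)).
Proof.
  intros Hg; apply CV_radius_bounded_ge_1; intros n.
  generalize (hyp_coef_bounds g n Hg); intros H; rewrite Rabs_pos_eq; lra.
Qed.

(** With an upper parameter 1 the Pochhammer symbol cancels the factorial, so the recurrence
    [hyp_coef_S] has linear factors and gives an equation of first order instead of Gauss's
    second-order one. [E2] is that recurrence summed up. *)
Lemma hyp2F1_ode (g x : R) :
  0 < g -> Rabs x < 1 ->
  let F := PSeries (hyp_coef g) x in
  let F' := PSeries (PS_derive (hyp_coef g)) x in
  g * (F - 1) + x * (1 - x) * F' - x * F = 0.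
Proof.
  intros Hg Hx F F'.
  assert (Hr := hyp_coef_radius g x Hg Hx).
  assert (He : ex_pseries (hyp_coef g) x) by now apply CV_radius_inside.
  assert (Hd : ex_pseries (PS_derive (hyp_coef g)) x)
    by (apply CV_radius_inside; now rewrite CV_radius_derive).
  assert (E1 : F = 1 + x * PSeries (PS_decr_1 (hyp_coef g)) x).
  { unfold F; rewrite PSeries_decr_1 by exact He; f_equal.
    unfold hyp_coef; simpl; field. }
  assert (Hs : ex_pseries (PS_decr_1 (hyp_coef g)) x).
  { apply CV_radius_inside, CV_radius_bounded_ge_1; [|exact Hx]; intros n.
    generalize (hyp_coef_bounds g (S n) Hg); intros H.
    unfold PS_decr_1; rewrite Rabs_pos_eq; lra. }
  assert (E2 : g * PSeries (PS_decr_1 (hyp_coef g)) x + F' = x * F' + F).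
  { unfold F', F; rewrite <- PSeries_incr_1, <- PSeries_scal.
    rewrite <- !PSeries_plus.
    - apply PSeries_ext; intros n.
      generalize (hyp_coef_S g n Hg).
      unfold PS_plus, PS_scal, PS_incr_1, PS_derive, PS_decr_1.
      destruct n as [|n]; unfold plus, scal, zero; cbn -[INR hyp_coef];
        unfold mult; cbn -[INR hyp_coef]; rewrite ?S_INR; [simpl INR|]; lra.
    - now apply ex_pseries_incr_1.
    - exact He.
    - apply ex_pseries_scal; [apply Rmult_comm|exact Hs].
    - exact Hd. }
  assert (E3 : g * (F - 1) = x * (g * PSeries (PS_decr_1 (hyp_coef g)) x))
    by (rewrite E1; ring).
  rewrite E3.
  replace (g * PSeries (PS_decr_1 (hyp_coef g)) x) with (x * F' + F - F') by lra.
  ring.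
Qed.

(* Pfaff's transform of [fun t => 2F1 (1, g; g + 1; -t)], i.e. of the moment
   series at [- t]; unlike the latter it is regular at [t = 1]. *)
Definition pfaff (g t : R) : R := PSeries (hyp_coef g) (t / (1 + t)) / (1 + t).

Lemma pfaff_0 (g : R) : pfaff g 0 = 1.
Proof.
  unfold pfaff; replace (0 / (1 + 0)) with 0 by field.
  rewrite PSeries_0; unfold hyp_coef; simpl; field.
Qed.

Lemma pfaff_1 (g : R) : pfaff g 1 = 1 / 2 * hyp2F1 1 1 (g + 1) (1 / 2).
Proof.
  unfold pfaff, hyp2F1; replace (1 / (1 + 1)) with (1 / 2) by field.
  unfold hyp_coef; field.
Qed.

(** For [x = t / (1 + t)] one has [1 - x = 1 / (1 + t)], and [hyp2F1_ode] becomes the equation of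
    the moment series along the ray through -1. Here it holds beyond the disc of that series, in
    particular at [t = 1]. *)
Lemma pfaff_ode (g t : R) :
  0 < g -> 0 <= t ->
  exists s, is_derive (pfaff g) t s /\ t * s + g * pfaff g t = g / (1 + t).
Proof.
  intros Hg Ht.
  assert (Hx : 0 <= t / (1 + t) < 1).
  { split; [apply Rdiv_le_0_compat; lra|apply Rlt_div_l; lra]. }
  assert (Hx' : Rabs (t / (1 + t)) < 1) by (rewrite Rabs_pos_eq; lra).
  generalize (hyp2F1_ode g _ Hg Hx').
  assert (Hd := is_derive_PSeries _ _ (hyp_coef_radius g _ Hg Hx')).
  set (F' := PSeries (PS_derive (hyp_coef g)) (t / (1 + t))) in *.
  set (F := PSeries (hyp_coef g) (t / (1 + t))); cbv zeta; intros E.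
  exists (F' / (1 + t) ^ 3 - F / (1 + t) ^ 2); split.
  - assert (Hq : is_derive (fun u => u / (1 + u)) t (/ (1 + t) ^ 2)).
    { auto_derive; [lra|field; lra]. }
    assert (Hi : is_derive (fun u => / (1 + u)) t (- / (1 + t) ^ 2)).
    { auto_derive; [lra|field; lra]. }
    assert (Hc := is_derive_comp (PSeries (hyp_coef g)) _ t _ _ Hd Hq).
    assert (Hm := is_derive_mult _ _ t _ _ Hc Hi Rmult_comm).
    unfold plus, scal, mult in Hm; simpl in Hm; unfold mult in Hm; simpl in Hm.
    fold F in Hm.
    replace (F' / (1 + t) ^ 3 - F / (1 + t) ^ 2) with
      (/ ((1 + t) * ((1 + t) * 1)) * F' * / (1 + t)
       + F * - / ((1 + t) * ((1 + t) * 1))) by (field; lra).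
    exact Hm.
  - unfold pfaff; fold F.
    assert (E' : g * (F - 1) * (1 + t) ^ 2 + t * F' - t * (1 + t) * F = 0).
    { rewrite <- (Rmult_0_l ((1 + t) ^ 2)), <- E; field; lra. }
    apply Rmult_eq_reg_r with ((1 + t) ^ 3); [|apply pow_nonzero; lra].
    replace ((t * (F' / (1 + t) ^ 3 - F / (1 + t) ^ 2) + g * (F / (1 + t)))
             * (1 + t) ^ 3) with (t * F' - t * (1 + t) * F + g * F * (1 + t) ^ 2)
      by (field; lra).
    replace (g / (1 + t) * (1 + t) ^ 3) with (g * (1 + t) ^ 2) by (field; lra).
    lra.
Qed.

(** The product is the hypergeometric series itself, with constant term 1 and positive coefficients.
    By [pfaff_ode] this inequality says that the derivative of [pfaff] is negative. *)
Lemma pfaff_gt (g t : R) : 0 < g -> 0 < t -> 1 < pfaff g t * (1 + t).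
Proof.
  intros Hg Ht.
  assert (Hx : 0 < t / (1 + t) < 1).
  { split; [apply Rdiv_lt_0_compat; lra|apply Rlt_div_l; lra]. }
  unfold pfaff; set (x := t / (1 + t)) in *.
  replace (PSeries (hyp_coef g) x / (1 + t) * (1 + t))
    with (PSeries (hyp_coef g) x) by (field; lra).
  assert (Hx' : Rabs x < 1) by (rewrite Rabs_pos_eq; lra).
  assert (Hb : forall k n, Rabs (hyp_coef g (k + n)) <= 1).
  { intros k n; generalize (hyp_coef_bounds g (k + n) Hg); intros H.
    rewrite Rabs_pos_eq; lra. }
  assert (Hr0 := CV_radius_bounded_ge_1 _ (Hb 0%nat) x Hx').
  assert (Hr1 := CV_radius_bounded_ge_1 _ (Hb 1%nat) x Hx').
  assert (Hr2 := CV_radius_bounded_ge_1 _ (Hb 2%nat) x Hx').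
  rewrite PSeries_decr_1 by now apply CV_radius_inside.
  rewrite (PSeries_decr_1 (PS_decr_1 (hyp_coef g)))
    by now apply CV_radius_inside.
  assert (H2 : 0 <= PSeries (PS_decr_1 (PS_decr_1 (hyp_coef g))) x).
  { apply PSeries_ge_0; [|lra|exact Hr2]; intros n.
    apply Rlt_le, (hyp_coef_bounds g (S (S n)) Hg). }
  assert (H1 : 0 < PS_decr_1 (hyp_coef g) 0) by apply (hyp_coef_bounds g 1 Hg).
  assert (H0 : hyp_coef g 0 = 1) by (unfold hyp_coef; simpl; field).
  rewrite H0; nra.
Qed.

(** Used to pass from [Cmod z] to a larger radius, and, strictly, from a radius below 1 to the value
    at 1. *)
Lemma pfaff_decreasing (g s t : R) :
  0 < g -> 0 <= s < t -> pfaff g t < pfaff g s.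
Proof.
  intros Hg Hst.
  destruct (MVT_cor2 (pfaff g) (Derive (pfaff g)) s t) as [c [E Hc]]; [lra| |].
  { intros c Hc; apply is_derive_Reals, Derive_correct.
    destruct (pfaff_ode g c Hg) as [d [Hd _]]; [lra|now exists d]. }
  destruct (pfaff_ode g c Hg) as [d [Hd Hode]]; [lra|].
  rewrite (is_derive_unique _ _ _ Hd) in E.
  assert (Hgt := pfaff_gt g c Hg ltac:(lra)).
  assert (Hd0 : d < 0).
  { assert (Hm : (c * d + g * pfaff g c) * (1 + c) = g)
      by (rewrite Hode; field; lra).
    assert (c * (1 + c) * d < 0) by nra.
    assert (0 < c * (1 + c)) by nra; nra. }
  nra.
Qed.

(** * Comparison of the moment series along rays *)

Lemma Re_pow_bound (z : C) (n : nat) : Cmod z <= 1 -> Rabs (Re (z ^ n)%C) <= 1.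
Proof.
  intros Hz; eapply Rle_trans; [apply re_le_Cmod|].
  rewrite Cmod_pow, <- (pow1 n); apply pow_incr; split; [apply Cmod_ge_0|exact Hz].
Qed.

Lemma Re_cpseries_ray (d : nat -> R) (z l : C) (t : R) :
  cpseries (fun n => RtoC (d n)) (RtoC t * z)%C l ->
  PSeries (fun n => d n * Re (z ^ n)%C) t = Re l.
Proof.
  intros Hl; apply cpseries_series, cseries_Re in Hl.
  apply is_series_unique; revert Hl; apply is_series_ext; intros n.
  rewrite Cpow_mult_l, <- RtoC_pow; destruct (z ^ n)%C; simpl; ring.
Qed.

Lemma Re_inv_one_minus (z : C) (t : R) :
  Cmod z = 1 -> 0 <= t < 1 -> / (1 + t) <= Re (/ (1 - RtoC t * z))%C.
Proof.
  intros Hz Ht; destruct z as [x y].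
  assert (Hxy : x * x + y * y = 1).
  { generalize (Cmod2_alt (x, y)); rewrite Hz; simpl; lra. }
  assert (Hx : -1 <= x <= 1) by nra.
  simpl.
  assert (Hpos : 0 < (1 + - (t * x - 0 * y)) ^ 2 + (0 + - (t * y + 0 * x)) ^ 2).
  { assert (0 < 1 - t * x) by nra; nra. }
  match goal with |- _ <= ?n / ?d =>
    replace d with (1 - 2 * t * x + t * t) by nra;
    replace n with (1 - t * x) by ring end.
  assert (Hp : 0 < 1 - 2 * t * x + t * t) by nra.
  apply Rle_div_r; [exact Hp|].
  apply Rmult_le_reg_l with (1 + t); [lra|].
  replace ((1 + t) * (/ (1 + t) * (1 - 2 * t * x + t * t)))
    with (1 - 2 * t * x + t * t) by (field; lra).
  (* This product is exactly the difference of the two sides; it vanishes at [x = -1], the extremal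
     direction. *)
  assert (0 <= t * (1 + x) * (1 - t)) by (apply Rmult_le_pos; nra); nra.
Qed.

Lemma Re_geometric_ray (z : C) (t : R) :
  Cmod z = 1 -> 0 <= t < 1 ->
  PSeries (fun n => Re (z ^ n)%C) t = Re (/ (1 - RtoC t * z))%C.
Proof.
  intros Hz Ht.
  rewrite <- (Re_cpseries_ray (fun _ => 1) z (/ (1 - RtoC t * z))%C t).
  - apply PSeries_ext; intros n; ring.
  - apply cpseries_geometric; unfold in_U.
    rewrite Cmod_mult, Cmod_R, Hz, Rabs_pos_eq; lra.
Qed.

(** The comparison is made with [pfaff] directly: it solves the equation with right side
    [g / (1 + t)], so its identification with a moment series can wait. *)
Lemma moment_ray_ge (g t : R) (z : C) :
  0 < g -> Cmod z = 1 -> 0 <= t < 1 ->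
  pfaff g t <= PSeries (fun n => moment g n * Re (z ^ n)%C) t.
Proof.
  intros Hg Hz Ht; apply Rminus_le_0.
  revert t Ht; apply (ode_nonneg g _
    (fun t => PSeries (PS_derive (fun n => moment g n * Re (z ^ n)%C)) t
              - Derive (pfaff g) t) Hg); intros t Ht;
    (destruct (moment_PSeries_ode g (fun n => Re (z ^ n)%C) t Hg) as [HX EX];
     [intros n; apply Re_pow_bound; lra|rewrite Rabs_pos_eq; lra|]);
    (destruct (pfaff_ode g t Hg) as [s [Hs Es]]; [lra|]);
    rewrite (is_derive_unique _ _ _ Hs).
  - apply (is_derive_minus _ _ _ _ _ HX Hs).
  - rewrite Re_geometric_ray in EX by assumption.
    generalize (Re_inv_one_minus z t Hz Ht); intros Hre.
    unfold Rdiv in Es; nra.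
Qed.

(** Serves the sharpness part. It is uniqueness for the singular equation: one inequality is
    [moment_ray_ge] at -1, the other applies [ode_nonneg] to the opposite difference, for which the
    right sides cancel. *)
Lemma moment_ray_neg (g t : R) :
  0 < g -> 0 <= t < 1 ->
  PSeries (fun n => moment g n * Re (RtoC (-1) ^ n)%C) t = pfaff g t.
Proof.
  intros Hg Ht.
  assert (Hz : Cmod (RtoC (-1)) = 1) by (rewrite Cmod_R, Rabs_left; lra).
  apply Rle_antisym; [|now apply moment_ray_ge].
  apply Rminus_le_0.
  revert t Ht; apply (ode_nonneg g _
    (fun t => Derive (pfaff g) t
       - PSeries (PS_derive (fun n => moment g n * Re (RtoC (-1) ^ n)%C)) t) Hg);
    intros t Ht;
    (destruct (moment_PSeries_ode g (fun n => Re (RtoC (-1) ^ n)%C) t Hg)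
       as [HX EX];
     [intros n; apply Re_pow_bound; lra|rewrite Rabs_pos_eq; lra|]);
    (destruct (pfaff_ode g t Hg) as [s [Hs Es]]; [lra|]);
    rewrite (is_derive_unique _ _ _ Hs).
  - apply (is_derive_minus _ _ _ _ _ Hs HX).
  - rewrite Re_geometric_ray in EX by assumption.
    replace (1 - RtoC t * RtoC (-1))%C with (RtoC (1 + t)) in EX
      by (rewrite <- RtoC_mult, <- RtoC_minus; f_equal; ring).
    rewrite <- RtoC_inv in EX by lra.
    change (Re (RtoC (/ (1 + t)))) with (/ (1 + t)) in EX.
    unfold Rdiv in Es; nra.
Qed.

Lemma Re_moment_series_ge (g r : R) (z l : C) :
  0 < g -> Cmod z <= r < 1 -> cpseries (fun n => RtoC (moment g n)) z l ->
  pfaff g r <= Re l.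
Proof.
  intros Hg Hz Hl; assert (Hz0 := Cmod_ge_0 z).
  apply Rle_trans with (pfaff g (Cmod z)).
  { destruct (Req_dec (Cmod z) r) as [E|E]; [rewrite E; lra|].
    apply Rlt_le, pfaff_decreasing; lra. }
  (* The origin lies on no particular ray; there both sides equal 1. *)
  destruct (Req_dec (Cmod z) 0) as [E|E].
  - rewrite E, pfaff_0; apply Cmod_eq_0 in E; rewrite E in Hl.
    rewrite (cpseries_unique _ _ _ _ Hl (cpseries_0 _)).
    unfold moment; simpl; apply Req_le; field; lra.
  - assert (Hne : RtoC (Cmod z) <> RtoC 0)
      by (intros E'; apply RtoC_inj in E'; lra).
    rewrite <- (Re_cpseries_ray (moment g) (z / RtoC (Cmod z))%C l (Cmod z)).
    + apply moment_ray_ge; [exact Hg| |lra].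
      rewrite Cmod_div, Cmod_R, Rabs_pos_eq by assumption; field; exact E.
    + replace (RtoC (Cmod z) * (z / RtoC (Cmod z)))%C with z; [exact Hl|].
      field; exact Hne.
Qed.

(** * Differentiability of complex power series *)

Lemma tame_shift (a : nat -> C) : tame a -> tame (fun n => a (S n)).
Proof.
  intros Ha r Hr; set (s := (1 + r) / 2).
  assert (Hs : 0 < s < 1) by (unfold s; lra).
  destruct (Ha s) as [M HM]; [lra|].
  exists (M / s); intros n; apply Rmult_le_reg_r with s; [lra|].
  replace (M / s * s) with M by (field; lra).
  eapply Rle_trans; [|apply (HM (S n))].
  change (s ^ S n) with (s * s ^ n).
  assert (r ^ n <= s ^ n) by (apply pow_incr; unfold s; lra).
  assert (0 <= Cmod (a (S n)) * s) by (apply Rmult_le_pos; [apply Cmod_ge_0|lra]).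
  nra.
Qed.

Lemma Cmod_csum_le (u : nat -> C) (K q : R) (n : nat) :
  0 <= q < 1 -> (forall k, Cmod (u k) <= K * q ^ k) ->
  Cmod (csum u n) <= K / (1 - q).
Proof.
  intros Hq Hu.
  assert (HK : 0 <= K).
  { generalize (Hu O) (Cmod_ge_0 (u O)); simpl; lra. }
  assert (H : Cmod (csum u n) * (1 - q) <= K * (1 - q ^ S n)).
  { induction n as [|n IH].
    - rewrite csum_0; generalize (Hu O); simpl; nra.
    - rewrite csum_S.
      apply Rle_trans with ((Cmod (csum u n) + K * q ^ S n) * (1 - q)).
      + apply Rmult_le_compat_r; [lra|].
        eapply Rle_trans; [apply Cmod_triangle|].
        apply Rplus_le_compat_l, Hu.
      + change (q ^ S (S n)) with (q * q ^ S n); lra. }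
  apply Rle_div_r; [lra|].
  assert (0 <= q ^ S n) by (apply pow_le; lra); nra.
Qed.

(** The Taylor remainder [D] of one power gives the next as [(z + h) * D] plus [h ^ 2] times the
    derivative term, and [k ^ 2 + k <= (k + 1) ^ 2] closes the induction. The factor [rho ^ 2] on
    the left avoids an exponent [n - 1] on the right. *)
Lemma pow_second_order (z h : C) (rho : R) (n : nat) :
  Cmod z <= rho -> Cmod (z + h)%C <= rho ->
  rho ^ 2 * Cmod ((z + h) ^ S n - z ^ S n - h * (RtoC (INR (S n)) * z ^ n))%C
    <= Cmod h ^ 2 * (INR (S n) ^ 2 * rho ^ S n).
Proof.
  intros Hz Hzh.
  assert (Hr : 0 <= rho) by (eapply Rle_trans; [apply Cmod_ge_0|exact Hz]).
  assert (Hh := Cmod_ge_0 h).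
  induction n as [|n IH].
  - replace ((z + h) ^ 1 - z ^ 1 - h * (RtoC (INR 1) * z ^ 0))%C with (RtoC 0)
      by (simpl; ring).
    rewrite Cmod_0, Rmult_0_r; simpl.
    repeat apply Rmult_le_pos; lra.
  - set (D := ((z + h) ^ S n - z ^ S n - h * (RtoC (INR (S n)) * z ^ n))%C) in *.
    replace ((z + h) ^ S (S n) - z ^ S (S n)
             - h * (RtoC (INR (S (S n))) * z ^ S n))%C
      with ((z + h) * D + h * h * (RtoC (INR (S n)) * z ^ n))%C
      by (unfold D; rewrite (S_INR (S n)), RtoC_plus, !Cpow_S; ring).
    assert (Hn : 0 <= INR (S n)) by apply pos_INR.
    assert (Hp : 0 <= rho ^ n) by now apply pow_le.
    assert (Hm : Cmod (h * h * (RtoC (INR (S n)) * z ^ n))%C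
                 <= Cmod h ^ 2 * (INR (S n) * rho ^ n)).
    { rewrite !Cmod_mult, Cmod_pow, Cmod_R, Rabs_pos_eq by exact Hn.
      simpl; rewrite Rmult_1_r; apply Rmult_le_compat_l; [nra|].
      apply Rmult_le_compat_l; [exact Hn|].
      apply pow_incr; split; [apply Cmod_ge_0|exact Hz]. }
    apply Rle_trans with (rho * (rho ^ 2 * Cmod D)
                          + rho ^ 2 * (Cmod h ^ 2 * (INR (S n) * rho ^ n))).
    + assert (Ht := Cmod_triangle ((z + h) * D)%C
                      (h * h * (RtoC (INR (S n)) * z ^ n))%C).
      rewrite Cmod_mult in Ht.
      assert (0 <= Cmod D) by apply Cmod_ge_0.
      assert (0 <= rho ^ 2) by now apply pow_le.
      assert (Cmod (z + h) * Cmod D <= rho * Cmod D) by nra.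
      nra.
    + rewrite (S_INR (S n)).
      replace (rho ^ S (S n)) with (rho * rho ^ S n) by reflexivity.
      assert (0 <= rho * rho ^ S n) by (apply Rmult_le_pos; [lra|now apply pow_le]).
      assert (rho ^ 2 * (Cmod h ^ 2 * (INR (S n) * rho ^ n))
              = Cmod h ^ 2 * INR (S n) * (rho * rho ^ S n)) as -> by (simpl; ring).
      apply Rle_trans with (Cmod h ^ 2 * (INR (S n) ^ 2) * (rho * rho ^ S n)
                            + Cmod h ^ 2 * INR (S n) * (rho * rho ^ S n)).
      * apply Rplus_le_compat_r; nra.
      * assert (0 <= Cmod h ^ 2 * (rho * rho ^ S n))
          by (apply Rmult_le_pos; [apply pow_le|]; assumption).
        nra.
Qed.

Lemma csum_split_head (u : nat -> C) (n : nat) :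
  csum u (S n) = (u O + csum (fun k => u (S k)) n)%C.
Proof.
  induction n as [|n IH]; [now rewrite csum_S, !csum_0|].
  rewrite csum_S, IH, csum_S; ring.
Qed.

(** Places the extremal functions in [Ap]. Summing [pow_second_order] over the terms bounds the
    remainder by a multiple of [Cmod h ^ 2]. *)
Lemma CPSeries_analytic (a : nat -> C) : tame a -> analytic_in_U (CPSeries a).
Proof.
  intros Ha z Hz.
  assert (Hz0 := Cmod_ge_0 z); unfold in_U in Hz.
  set (b := fun n => (RtoC (INR (S n)) * a (S n))%C).
  assert (Hb : tame b).
  { apply (tame_shift (fun n => RtoC (INR n) * a n)%C), tame_mult;
      [apply tame_nat|exact Ha]. }
  destruct (tame_convergent b z Hb Hz) as [D HD].
  exists D.
  set (rho := (1 + Cmod z) / 2).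
  assert (Hrho : 0 < rho < 1) by (unfold rho; lra).
  (* The squares in [pow_second_order] call for a geometric bound on [(n + 1) ^ 2 * a (n + 1)]. *)
  assert (Haa : tame (fun n => RtoC (INR (S n)) * b n)%C).
  { apply (tame_shift (fun n => RtoC (INR n) * (RtoC (INR n) * a n))%C).
    apply tame_mult; [apply tame_nat|].
    apply tame_mult; [apply tame_nat|exact Ha]. }
  destruct (tame_geometric _ rho Haa) as [K [q [HK [Hq Hgeo]]]]; [lra|].
  assert (Hbound : forall h, Cmod h <= rho - Cmod z ->
    rho * Cmod (CPSeries a (z + h)%C - CPSeries a z - h * D)%C
      <= Cmod h ^ 2 * (K / (1 - q))).
  { intros h Hh.
    assert (Hzh : Cmod (z + h)%C <= rho)
      by (eapply Rle_trans; [apply Cmod_triangle|]; lra).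
    assert (Hzh1 : in_U (z + h)%C) by (unfold in_U; lra).
    assert (E0 := CPSeries_expansion a Ha z Hz).
    assert (E1 := CPSeries_expansion a Ha _ Hzh1).
    set (f0 := CPSeries a z) in *; set (f1 := CPSeries a (z + h)%C) in *.
    apply Rnot_lt_le; intros Hlt.
    set (B := Cmod h ^ 2 * (K / (1 - q))) in *.
    set (T := Cmod (f1 - f0 - h * D)%C) in *.
    (* Replacing the three sums by partial sums costs at most [3 * eps], since [Cmod h < 1]; the
       supposed gap is worth [4 * eps]. *)
    set (eps := (rho * T - B) / (4 * rho)).
    assert (He : 0 < eps) by (unfold eps; apply Rdiv_lt_0_compat; lra).
    assert (He' : rho * (4 * eps) = rho * T - B) by (unfold eps; field; lra).
    rewrite cpseries_series, cseries_eps in HD, E0, E1.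
    destruct (HD eps He) as [N1 H1]; destruct (E0 eps He) as [N2 H2];
      destruct (E1 eps He) as [N3 H3].
    set (n := (N1 + N2 + N3)%nat).
    specialize (H1 n ltac:(lia)); specialize (H2 (S n) ltac:(lia));
      specialize (H3 (S n) ltac:(lia)).
    set (S1 := csum (fun k => (b k * z ^ k)%C) n) in *.
    set (S2 := csum (fun k => (a k * z ^ k)%C) (S n)) in *.
    set (S3 := csum (fun k => (a k * (z + h) ^ k)%C) (S n)) in *.
    assert (HS : rho * Cmod (S3 - S2 - h * S1)%C <= B).
    { set (u := fun k => (a (S k) * ((z + h) ^ S k - z ^ S k
                            - h * (RtoC (INR (S k)) * z ^ k)))%C).
      assert (Eu : (S3 - S2 - h * S1)%C = csum u n).
      { unfold S1, S2, S3; rewrite !csum_split_head.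
        transitivity (csum (fun k => (a (S k) * (z + h) ^ S k)%C) n
                      - csum (fun k => (a (S k) * z ^ S k)%C) n
                      - h * csum (fun k => (b k * z ^ k)%C) n)%C;
          [simpl; ring|].
        clear; induction n as [|n IH].
        - rewrite !csum_0; unfold u, b; ring.
        - rewrite !csum_S, <- IH; unfold u, b; ring. }
      rewrite Eu.
      assert (Hu : Cmod (csum u n) <= Cmod h ^ 2 * K / rho / (1 - q)).
      { apply Cmod_csum_le; [exact Hq|]; intros k.
        unfold u; rewrite Cmod_mult.
        assert (Hk := pow_second_order z h rho k ltac:(unfold rho; lra) Hzh).
        set (X := Cmod ((z + h) ^ S k - z ^ S k
                        - h * (RtoC (INR (S k)) * z ^ k))%C) in *.
        specialize (Hgeo (RtoC rho) k).
        rewrite Cmod_R, Rabs_pos_eq in Hgeo by lra.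
        specialize (Hgeo (Rle_refl _)).
        unfold b in Hgeo; rewrite !Cmod_mult, Cmod_pow, !Cmod_R in Hgeo.
        rewrite (Rabs_pos_eq rho) in Hgeo by lra.
        rewrite Rabs_pos_eq in Hgeo by apply pos_INR.
        assert (0 <= Cmod (a (S k))) by apply Cmod_ge_0.
        assert (0 <= Cmod h ^ 2) by (apply pow_le, Cmod_ge_0).
        apply Rmult_le_reg_l with (rho ^ 2); [apply pow_lt; lra|].
        apply Rle_trans with
          (Cmod (a (S k)) * (Cmod h ^ 2 * (INR (S k) ^ 2 * rho ^ S k))).
        - replace (rho ^ 2 * (Cmod (a (S k)) * X))
            with (Cmod (a (S k)) * (rho ^ 2 * X)) by ring.
          now apply Rmult_le_compat_l.
        - replace (Cmod (a (S k)) * (Cmod h ^ 2 * (INR (S k) ^ 2 * rho ^ S k)))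
            with (rho * Cmod h ^ 2
                  * (INR (S k) * (INR (S k) * Cmod (a (S k))) * rho ^ k))
            by (simpl; ring).
          replace (rho ^ 2 * (Cmod h ^ 2 * K / rho * q ^ k))
            with (rho * Cmod h ^ 2 * (K * q ^ k)) by (field; lra).
          apply Rmult_le_compat_l; [apply Rmult_le_pos; lra|exact Hgeo]. }
      replace B with (rho * (Cmod h ^ 2 * K / rho / (1 - q)))
        by (unfold B; field; lra).
      apply Rmult_le_compat_l; lra. }
    assert (HT : T <= Cmod (S3 - S2 - h * S1)%C + 3 * eps).
    { unfold T.
      replace (f1 - f0 - h * D)%C
        with ((S3 - S2 - h * S1) + (- (S3 - f1) + ((S2 - f0) + h * (S1 - D))))%C
        by ring.
      eapply Rle_trans; [apply Cmod_triangle|]; apply Rplus_le_compat_l.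
      eapply Rle_trans; [apply Cmod_triangle|].
      rewrite Cmod_opp.
      assert (Hx := Cmod_triangle (S2 - f0) (h * (S1 - D))).
      rewrite Cmod_mult in Hx.
      assert (Cmod h * Cmod (S1 - D) <= Cmod (S1 - D)).
      { assert (0 <= Cmod (S1 - D)) by apply Cmod_ge_0; nra. }
      lra. }
    nra. }
  split; [apply (is_linear_scal_l (K := C_AbsRing) (V := C_NormedModule))|].
  intros x Hx eps.
  apply (is_filter_lim_locally_unique (K := C_AbsRing)
           (V := AbsRing_NormedModule C_AbsRing)) in Hx; subst x.
  set (L := K / (1 - q)).
  assert (HL : 0 <= L) by (unfold L; apply Rdiv_le_0_compat; lra).
  assert (Heps := cond_pos eps).
  set (delta := Rmin (rho - Cmod z) (rho * eps / (L + 1))).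
  assert (Hdelta : 0 < delta).
  { apply Rmin_glb_lt; [unfold rho; lra|].
    apply Rdiv_lt_0_compat; nra. }
  exists (mkposreal delta Hdelta); intros y Hy.
  change (Cmod (y - z)%C < delta) in Hy.
  change (Cmod (CPSeries a y - CPSeries a z - (y - z) * D)%C
          <= eps * Cmod (y - z)%C).
  assert (Hd1 : delta <= rho - Cmod z) by apply Rmin_l.
  assert (Hd2 : delta <= rho * eps / (L + 1)) by apply Rmin_r.
  specialize (Hbound (y - z)%C ltac:(lra)).
  assert (Ey : (z + (y - z))%C = y) by ring.
  rewrite Ey in Hbound; fold L in Hbound.
  assert (Hh := Cmod_ge_0 (y - z)%C).
  apply Rle_div_r in Hd2; [|lra].
  apply Rmult_le_reg_l with rho; [lra|].
  eapply Rle_trans; [exact Hbound|].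
  set (e := pos eps) in *; set (x := Cmod (y - z)%C) in *.
  assert (Hx : x * L <= rho * e) by nra.
  replace (x ^ 2 * L) with (x * (x * L)) by ring.
  replace (rho * (e * x)) with (x * (rho * e)) by ring.
  now apply Rmult_le_compat_l.
Qed.

(** * Taylor coefficients of the operators *)

(** What [normalized] becomes after division by [z ^ p]. The entry [u O] is overridden because the
    coefficient sequence in [Ap] is arbitrary at index [p]. *)
Definition unit_head (u : nat -> C) (n : nat) : C :=
  match n with O => RtoC 1 | S _ => u n end.

Lemma cpseries_ext (a b : nat -> C) (z l : C) :
  (forall n, a n = b n) -> cpseries a z l -> cpseries b z l.
Proof. intros E; apply is_pseries_ext, E. Qed.

Lemma cpseries_scal (a : nat -> C) (c z l : C) :
  cpseries a z l -> cpseries (fun n => (c * a n)%C) z (c * l)%C.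
Proof.
  intros H; apply cpseries_series in H; apply cpseries_series.
  apply (is_series_ext (fun n => (c * (a n * z ^ n))%C)).
  { intros n; change (c * (a n * z ^ n) = c * a n * z ^ n)%C; ring. }
  exact (is_series_scal (K := C_AbsRing) (V := C_NormedModule) c _ _ H).
Qed.

Lemma cpseries_plus (a b : nat -> C) (z l l' : C) :
  cpseries a z l -> cpseries b z l' ->
  cpseries (fun n => (a n + b n)%C) z (l + l')%C.
Proof. apply (is_pseries_plus (K := C_AbsRing) (V := C_NormedModule)). Qed.

Lemma cpseries_unit_head (u : nat -> C) (z l : C) :
  cpseries u z l -> cpseries (unit_head u) z (l - u O + 1)%C.
Proof.
  rewrite !cpseries_series, !cseries_eps; intros H eps He.
  destruct (H eps He) as [N HN]; exists N; intros n Hn.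
  replace (csum (fun k => (unit_head u k * z ^ k)%C) n)
    with (csum (fun k => (u k * z ^ k)%C) n - u O + 1)%C.
  - replace (csum (fun k => (u k * z ^ k)%C) n - u O + 1 - (l - u O + 1))%C
      with (csum (fun k => (u k * z ^ k)%C) n - l)%C by ring.
    now apply HN.
  - transitivity (csum (fun k => match k with
      | O => RtoC 1 | S _ => (u k * z ^ k)%C end) n).
    + rewrite csum_head; simpl; ring.
    + apply csum_ext; intros [|k] _; simpl; ring.
Qed.

Lemma normalized_shift (p : nat) (u : nat -> C) (n : nat) :
  normalized p u (p + n)%nat = unit_head (fun k => u (p + k)%nat) n.
Proof.
  unfold normalized.
  replace (Nat.ltb (p + n) p) with false by (symmetry; apply Nat.ltb_ge; lia).
  destruct n as [|n]; simpl unit_head.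
  - now rewrite Nat.add_0_r, Nat.eqb_refl.
  - now replace (Nat.eqb (p + S n) p) with false
      by (symmetry; apply Nat.eqb_neq; lia).
Qed.

Lemma normalized_lt (p : nat) (u : nat -> C) (k : nat) :
  (k < p)%nat -> normalized p u k = RtoC 0.
Proof. intros H; unfold normalized; now rewrite (proj2 (Nat.ltb_lt k p) H). Qed.

Lemma normalized_gt (p : nat) (u : nat -> C) (k : nat) :
  (p < k)%nat -> normalized p u k = u k.
Proof.
  intros H; unfold normalized.
  rewrite (proj2 (Nat.ltb_ge k p)), (proj2 (Nat.eqb_neq k p)); [reflexivity|lia|lia].
Qed.

Lemma normalized_ext (p : nat) (u v : nat -> C) :
  (forall k, (p < k)%nat -> u k = v k) ->
  forall k, normalized p u k = normalized p v k.
Proof.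
  intros H k; unfold normalized.
  destruct (Nat.ltb_spec k p); [reflexivity|].
  destruct (Nat.eqb_spec k p); [reflexivity|]. apply H; lia.
Qed.

Lemma has_expansion_ext (f : C -> C) (a b : nat -> C) :
  (forall n, a n = b n) -> has_expansion f a -> has_expansion f b.
Proof. intros E H z Hz; apply (cpseries_ext a), H, Hz; exact E. Qed.

Lemma tame_normalized (p : nat) (u v : nat -> C) :
  tame v -> (forall k, (p < k)%nat -> Cmod (u k) <= Cmod (v k)) ->
  tame (normalized p u).
Proof.
  intros Hv H r Hr; destruct (Hv r Hr) as [M HM]; exists (M + 1); intros k.
  assert (HM0 : 0 <= M).
  { generalize (HM O) (Cmod_ge_0 (v O)); simpl; lra. }
  assert (Hp : 0 <= r ^ k <= 1).
  { split; [apply pow_le; lra|]. rewrite <- (pow1 k); apply pow_incr; lra. }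
  unfold normalized; destruct (Nat.ltb_spec k p); [rewrite Cmod_0; lra|].
  destruct (Nat.eqb_spec k p); [rewrite Cmod_1; lra|].
  specialize (H k ltac:(lia)); specialize (HM k); nra.
Qed.

Definition ratio (p : nat) (alpha beta : R) (k : nat) : R :=
  (alpha + INR k * beta) / (alpha + INR p * beta).

Section Operator.

Context (p : nat) (alpha beta : R).
Context (hbeta : 0 < beta) (hab : 0 < alpha + INR p * beta).

Local Notation lam := (ratio p alpha beta).

(** The upper bound makes positive powers grow polynomially, the lower bound keeps negative powers
    below 1; so the multipliers preserve [tame] for either sign of [m]. *)
Lemma ratio_bounds (k : nat) :
  (p <= k)%nat ->
  1 <= lam k <= 1 + INR k * (beta / (alpha + INR p * beta)).
Proof.
  intros Hk; apply le_INR in Hk; assert (0 <= INR p) by apply pos_INR.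
  unfold ratio; split.
  - apply Rle_div_r; nra.
  - apply Rle_div_l; [exact hab|].
    replace ((1 + INR k * (beta / (alpha + INR p * beta)))
             * (alpha + INR p * beta))
      with (alpha + INR p * beta + INR k * beta) by (field; lra).
    nra.
Qed.

Lemma tame_ratio_pow (j : nat) :
  tame (fun k => RtoC ((1 + INR k * (beta / (alpha + INR p * beta))) ^ j)).
Proof.
  induction j as [|j IH].
  - apply (tame_bounded _ 1); intros n; simpl; rewrite Cmod_1; lra.
  - apply (tame_le _ (fun k => (RtoC (1 + INR k * (beta / (alpha + INR p * beta)))
      * RtoC ((1 + INR k * (beta / (alpha + INR p * beta))) ^ j))%C)).
    + apply tame_mult; [|exact IH].
      apply (tame_le _ (fun k => (1 + RtoC (INR k)
               * RtoC (beta / (alpha + INR p * beta)))%C)).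
      * apply tame_plus; [apply (tame_bounded _ 1); intros n; rewrite Cmod_1; lra|].
        apply tame_mult; [apply tame_nat|].
        apply (tame_bounded _ (Cmod (RtoC (beta / (alpha + INR p * beta))))).
        intros; apply Rle_refl.
      * intros n; rewrite RtoC_plus, RtoC_mult; apply Rle_refl.
    + intros n; rewrite <- RtoC_mult; apply Rle_refl.
Qed.

Lemma powerRZ_le_pow (x y : R) (m : Z) :
  1 <= x <= y -> 0 < powerRZ x m <= y ^ Z.abs_nat m.
Proof.
  intros Hx; split; [apply powerRZ_lt; lra|].
  assert (H1 : forall j, 1 <= x ^ j) by (intros j; apply pow_R1_Rle; lra).
  destruct m as [|n|n]; simpl.
  - lra.
  - apply pow_incr; lra.
  - apply Rle_trans with (x ^ Pos.to_nat n); [|apply pow_incr; lra].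
    apply Rle_trans with 1; [|apply H1].
    rewrite <- Rinv_1; apply Rinv_le_contravar; [lra|apply H1].
Qed.

Lemma tame_powerRZ_ratio (m : Z) (b : nat -> C) :
  tame b -> tame (normalized p (fun k => RtoC (powerRZ (lam k) m) * b k)%C).
Proof.
  intros Hb; apply (tame_normalized p _ _
    (tame_mult _ _ (tame_ratio_pow (Z.abs_nat m)) Hb)); intros k Hk.
  rewrite !Cmod_mult; apply Rmult_le_compat_r; [apply Cmod_ge_0|].
  assert (H := powerRZ_le_pow _ _ m (ratio_bounds k ltac:(lia))).
  rewrite !Cmod_R, !Rabs_pos_eq; lra.
Qed.

Lemma Theta_expansion (m : Z) (f : C -> C) (a : nat -> C) :
  has_expansion f (normalized p a) ->
  has_expansion (Theta p m alpha beta f)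
    (normalized p (fun k => RtoC (powerRZ (lam k) m) * a k)%C).
Proof.
  intros Hf.
  apply (has_expansion_ext _ (normalized p
    (fun k => RtoC (powerRZ (lam k) m) * coef f k)%C)).
  - apply normalized_ext; intros k Hk.
    now rewrite (coef_expansion f _ k Hf), normalized_gt.
  - apply CPSeries_expansion, tame_powerRZ_ratio.
    apply (tame_le _ (normalized p a)); [now apply (tame_expansion f)|].
    intros n; rewrite (coef_expansion f _ n Hf); apply Rle_refl.
Qed.

Lemma hadamard_expansion (f1 f2 : C -> C) (a1 a2 : nat -> C) :
  has_expansion f1 (normalized p a1) -> has_expansion f2 (normalized p a2) ->
  has_expansion (hadamard p f1 f2) (normalized p (fun k => a1 k * a2 k)%C).
Proof.
  intros H1 H2.
  apply (has_expansion_ext _ (normalized p (fun k => coef f1 k * coef f2 k)%C)).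
  - apply normalized_ext; intros k Hk.
    now rewrite (coef_expansion f1 _ k H1), (coef_expansion f2 _ k H2),
      !normalized_gt.
  - apply CPSeries_expansion.
    apply (tame_normalized p _ _ (tame_mult _ _ (tame_expansion _ _ H1)
                                                (tame_expansion _ _ H2))).
    intros k Hk; rewrite (coef_expansion f1 _ k H1), (coef_expansion f2 _ k H2).
    apply Rle_refl.
Qed.

Lemma div_zp_series (F : C -> C) (u : nat -> C) (z : C) :
  has_expansion F (normalized p u) -> in_U z ->
  cpseries (unit_head (fun n => u (p + n)%nat)) z (div_zp p F z).
Proof.
  intros HF Hz; unfold div_zp.
  destruct (Ceq_dec z (RtoC 0)) as [->|Hne].
  - assert (E := normalized_shift p u 0); rewrite Nat.add_0_r in E.
    rewrite (coef_expansion F _ p HF), E; apply cpseries_0.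
  - apply (cpseries_ext (fun n => normalized p u (p + n)%nat));
      [apply normalized_shift|].
    assert (HFz := HF z Hz); rewrite cpseries_series in HFz.
    apply cpseries_series.
    set (v := fun n => (normalized p u n * z ^ n)%C) in HFz.
    assert (Hs : cseries (fun n => v (p + n)%nat) (F z)).
    { rewrite cseries_eps in HFz |- *; intros eps He.
      destruct (HFz eps He) as [N HN]; exists N; intros n Hn.
      replace (csum (fun k => v (p + k)%nat) n) with (csum v (p + n)).
      - apply HN; lia.
      - clear Hn; induction n as [|n IH].
        + rewrite csum_0; apply csum_single; [lia|]; intros k Hk Hkn.
          unfold v; rewrite normalized_lt by lia; ring.
        + rewrite Nat.add_succ_r, !csum_S, IH, Nat.add_succ_r; reflexivity. }
    assert (Hp : (z ^ p)%C <> RtoC 0) by now apply Cpow_nz.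
    apply (is_series_ext (fun n => (/ z ^ p * v (p + n)%nat)%C)).
    + intros n.
      change (/ z ^ p * v (p + n)%nat = normalized p u (p + n)%nat * z ^ n)%C.
      unfold v; rewrite Cpow_add_r; field; exact Hp.
    + replace (F z / z ^ p)%C with (/ z ^ p * F z)%C by (field; exact Hp).
      exact (is_series_scal (K := C_AbsRing) (V := C_NormedModule) _ _ _ Hs).
Qed.

Context (mu : R) (hmu : 0 < mu) (m : Z).

Local Notation gam := ((alpha + INR p * beta) / (mu * beta)).

Lemma gam_pos : 0 < gam.
Proof. apply Rdiv_lt_0_compat; nra. Qed.

Definition mix_coef (a : nat -> C) (n : nat) : C :=
  (RtoC (powerRZ (lam (p + n)) m / moment gam n) * a (p + n)%nat)%C.

(** The origin of [gam]: the left side is [1 + n * mu * beta / (alpha + p * beta)], that is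
    [(gam + n) / gam]. *)
Lemma ratio_shift (n : nat) : 1 - mu + mu * lam (p + n) = / moment gam n.
Proof.
  assert (Hg := gam_pos); generalize (pos_INR n); intros Hn.
  unfold moment, ratio; rewrite plus_INR.
  assert (0 < mu * beta) by nra.
  field; repeat split; try lra.
  assert (0 <= INR n * (mu * beta)) by (apply Rmult_le_pos; lra); nra.
Qed.

Lemma Theta_mix_series (f : C -> C) (a : nat -> C) (z : C) :
  has_expansion f (normalized p a) -> in_U z ->
  cpseries (unit_head (mix_coef a)) z (Theta_mix p m alpha beta mu f z).
Proof.
  intros Hf Hz; unfold Theta_mix.
  assert (H0 := div_zp_series _ _ z (Theta_expansion m f a Hf) Hz).
  assert (H1 := div_zp_series _ _ z (Theta_expansion (m + 1) f a Hf) Hz).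
  eapply cpseries_ext;
    [|exact (cpseries_plus _ _ _ _ _ (cpseries_scal _ (RtoC (1 - mu)) _ _ H0)
                                     (cpseries_scal _ (RtoC mu) _ _ H1))].
  intros [|n]; unfold unit_head, mix_coef; cbv beta.
  - rewrite !Cmult_1_r, <- RtoC_plus; f_equal; ring.
  - assert (Hl := ratio_bounds (p + S n) ltac:(lia)).
    unfold Rdiv; rewrite <- ratio_shift, powerRZ_add, powerRZ_1 by lra.
    rewrite RtoC_minus, !RtoC_mult, RtoC_plus, RtoC_minus, RtoC_mult; ring.
Qed.

(** Both sides carry the power [2 * m] of the ratio, one from [H] and one from the mixture. The
    mixture divides by [moment] once, the product of two [mix_coef] twice, so one factor [moment]
    remains. It is bracketed for two successive convolutions. *)
Lemma Theta_mix_hadamard_series (f1 f2 : C -> C) (a1 a2 : nat -> C) (z : C) :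
  has_expansion f1 (normalized p a1) -> has_expansion f2 (normalized p a2) ->
  in_U z ->
  cpseries (unit_head (fun n => mix_coef a2 n
                                * (mix_coef a1 n * RtoC (moment gam n)))%C) z
    (Theta_mix p m alpha beta mu (Theta p m alpha beta (hadamard p f1 f2)) z).
Proof.
  intros H1 H2 Hz.
  assert (HH := Theta_mix_series _ _ z
                  (Theta_expansion m _ _ (hadamard_expansion _ _ _ _ H1 H2)) Hz).
  revert HH; apply cpseries_ext; intros [|n]; [reflexivity|].
  unfold unit_head, mix_coef.
  assert (Hm := proj1 (moment_bounds gam (S n) gam_pos)).
  set (d := moment _ (S n)) in *.
  rewrite !RtoC_div by lra.
  field; intros E; apply RtoC_inj in E; lra.
Qed.

End Operator.

(** * From Janowski subordination to Caratheodory functions *)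

Lemma janowski_Re_gt (A B : R) (w : C) :
  -1 <= B /\ B < A /\ A <= 1 -> in_U w ->
  (1 - A) / (1 - B) < Re (janowski A B w).
Proof.
  intros [HB [HAB HA]] Hw; destruct w as [x y].
  assert (Hq : x * x + y * y < 1).
  { generalize (Cmod2_alt (x, y)) (Cmod_ge_0 (x, y)); unfold in_U in Hw.
    simpl; nra. }
  assert (Hx : -1 < x < 1) by nra.
  unfold janowski; simpl.
  set (den := (1 + (B * x - 0 * y)) ^ 2 + (0 + (B * y + 0 * x)) ^ 2).
  assert (Eden : den = 1 + 2 * B * x + B * B * (x * x + y * y))
    by (unfold den; ring).
  assert (Hden : 0 < den).
  { assert (0 < 1 + B * x) by nra.
    unfold den; nra. }
  match goal with |- _ < ?e => replace e with
    ((1 + (A + B) * x + A * B * (x * x + y * y)) / den)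
    by (unfold den in *; field; lra) end.
  apply Rlt_div_l; [lra|].
  apply Rmult_lt_reg_r with den; [exact Hden|].
  replace ((1 + (A + B) * x + A * B * (x * x + y * y)) / den * (1 - B) * den)
    with ((1 + (A + B) * x + A * B * (x * x + y * y)) * (1 - B)) by (field; lra).
  apply Rminus_lt_0; rewrite Eden.
  set (q := x * x + y * y) in *.
  assert (Hx1 : 0 <= 1 + 2 * x + q) by (unfold q; nra).
  (* The difference is a convex combination of [1 - q], which is positive in the disc, and
     [1 + 2 * x + q], the squared modulus of [1 + w]. For [B = -1] only the first remains. *)
  replace ((1 + (A + B) * x + A * B * q) * (1 - B)
           - (1 - A) * (1 + 2 * B * x + B * B * q))
    with ((A - B) * ((1 - B) / 2 * (1 - q) + (1 + B) / 2 * (1 + 2 * x + q)))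
    by field.
  apply Rmult_lt_0_compat; [lra|].
  assert (0 < (1 - B) / 2 * (1 - q)) by (apply Rmult_lt_0_compat; lra).
  assert (0 <= (1 + B) / 2 * (1 + 2 * x + q)) by (apply Rmult_le_pos; lra).
  lra.
Qed.

(** The factor [(1 - B) / (A - B)] is that of the dilation about 1 which carries the line
    [Re = (1 - A) / (1 - B)] to the imaginary axis. *)
Lemma janowski_caratheodory (A B : R) (phi : C -> C) (c : nat -> C) :
  -1 <= B /\ B < A /\ A <= 1 ->
  has_expansion phi (unit_head c) -> subordinate phi (janowski A B) ->
  let q := unit_head (fun n => RtoC ((1 - B) / (A - B)) * c n)%C in
  tame q /\ forall z l, in_U z -> cpseries q z l -> 0 <= Re l.
Proof.
  intros HAB Hphi [w [_ [Hw [_ Hsub]]]] q.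
  assert (HAB' : 0 < A - B) by lra; assert (HB' : 0 < 1 - B) by lra.
  set (K := (1 - B) / (A - B)).
  assert (HK : 0 < K) by (unfold K; apply Rdiv_lt_0_compat; lra).
  assert (Hval : forall z, in_U z ->
    cpseries q z (RtoC K * phi z - RtoC K + 1)%C).
  { intros z Hz.
    assert (H := cpseries_unit_head _ _ _ (cpseries_scal _ (RtoC K) _ _ (Hphi z Hz))).
    replace (RtoC K * phi z - RtoC K + 1)%C
      with (RtoC K * phi z - RtoC K * unit_head c 0 + 1)%C by (simpl; ring).
    revert H; apply cpseries_ext; intros [|n]; reflexivity. }
  split; [apply (tame_expansion _ _ Hval)|].
  intros z l Hz Hl.
  rewrite (cpseries_unique _ _ _ _ Hl (Hval z Hz)), (Hsub z Hz).
  assert (Hj := janowski_Re_gt A B (w z) HAB (Hw z Hz)).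
  set (J := janowski A B (w z)) in *.
  assert (E : K * ((1 - A) / (1 - B)) = K - 1) by (unfold K; field; lra).
  assert (K * ((1 - A) / (1 - B)) < K * Re J) by now apply Rmult_lt_compat_l.
  rewrite re_plus; unfold Cminus; rewrite re_plus, re_scal_l, re_opp, !re_RtoC; lra.
Qed.

(** * The bound and its sharpness *)

Lemma tame_moment (g : R) : 0 < g -> tame (fun n => RtoC (moment g n)).
Proof.
  intros Hg; apply (tame_bounded _ 1); intros n.
  generalize (moment_bounds g n Hg); intros H; rewrite Cmod_R, Rabs_pos_eq; lra.
Qed.

Lemma moment_convolution_Re_ge (g r : R) (q1 q2 : nat -> C) (z l : C) :
  0 < g -> Cmod z < r < 1 ->
  tame q1 -> tame q2 -> q1 O = RtoC 1 -> q2 O = RtoC 1 ->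
  (forall z l, in_U z -> cpseries q1 z l -> 0 <= Re l) ->
  (forall z l, in_U z -> cpseries q2 z l -> 0 <= Re l) ->
  cpseries (fun n => q2 n * (q1 n * RtoC (moment g n)))%C z l ->
  4 * pfaff g r - 3 <= Re l.
Proof.
  intros Hg Hz T1 T2 E1 E2 P1 P2 Hl.
  assert (Td := tame_moment g Hg).
  assert (Hd0 : moment g 0 = 1) by (unfold moment; simpl; field; lra).
  assert (H1 : forall z l, Cmod z < r ->
    cpseries (fun n => q1 n * RtoC (moment g n))%C z l ->
    2 * pfaff g r - 1 <= Re l).
  { intros y k Hy Hk.
    assert (H := convolution_Re_ge q1 _ r (pfaff g r) T1 Td E1 ltac:(lra) P1
      (fun x t Hx Ht => Re_moment_series_ge g r x t Hg ltac:(lra) Ht) y k Hy Hk).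
    cbv beta in H; rewrite Hd0 in H; change (Re (RtoC 1)) with 1 in H; lra. }
  assert (H := convolution_Re_ge q2 _ r _ T2 (tame_mult _ _ T1 Td) E2
    ltac:(lra) P2 H1 z l ltac:(lra) Hl).
  cbv beta in H; rewrite E1, Hd0, Cmult_1_l in H; change (Re (RtoC 1)) with 1 in H; lra.
Qed.

Section Bound.

Context (p : nat) (m : Z) (alpha beta mu : R).
Context (hbeta : 0 < beta) (hab : 0 < alpha + INR p * beta) (hmu : 0 < mu).

Local Notation gam := ((alpha + INR p * beta) / (mu * beta)).

Lemma hadamard_Re_bound (A1 B1 A2 B2 : R) :
  -1 <= B1 /\ B1 < A1 /\ A1 <= 1 -> -1 <= B2 /\ B2 < A2 /\ A2 <= 1 ->
  Re_bound p m alpha beta mu A1 B1 A2 B2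
    (1 - 4 * (A1 - B1) * (A2 - B2) / ((1 - B1) * (1 - B2)) * (1 - pfaff gam 1)).
Proof.
  intros h1 h2 f1 f2 [_ [a1 Ha1]] [_ [a2 Ha2]] S1 S2 H z Hz.
  assert (Hg := gam_pos p alpha beta hbeta hab mu hmu).
  set (c1 := mix_coef p alpha beta mu m a1).
  set (c2 := mix_coef p alpha beta mu m a2).
  destruct (janowski_caratheodory A1 B1 _ c1 h1
    (fun z => Theta_mix_series p alpha beta hbeta hab mu hmu m f1 a1 z Ha1) S1)
    as [T1 P1].
  destruct (janowski_caratheodory A2 B2 _ c2 h2
    (fun z => Theta_mix_series p alpha beta hbeta hab mu hmu m f2 a2 z Ha2) S2)
    as [T2 P2].
  set (q1 := unit_head (fun n => RtoC ((1 - B1) / (A1 - B1)) * c1 n)%C) in *.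
  set (q2 := unit_head (fun n => RtoC ((1 - B2) / (A2 - B2)) * c2 n)%C) in *.
  assert (HH := Theta_mix_hadamard_series p alpha beta hbeta hab mu hmu m
                  f1 f2 a1 a2 z Ha1 Ha2 Hz).
  fold H c1 c2 in HH.
  destruct (tame_convergent _ z
    (tame_mult _ _ T2 (tame_mult _ _ T1 (tame_moment gam Hg))) Hz) as [l Hl].
  unfold in_U in Hz; set (r := (1 + Cmod z) / 2).
  assert (Hl' := moment_convolution_Re_ge gam r q1 q2 z l Hg
    ltac:(unfold r; lra) T1 T2 eq_refl eq_refl P1 P2 Hl).
  set (K := (A1 - B1) / (1 - B1) * ((A2 - B2) / (1 - B2))).
  assert (HK : 0 < K)
    by (apply Rmult_lt_0_compat; apply Rdiv_lt_0_compat; lra).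
  assert (Hd0 : moment gam 0 = 1) by (unfold moment; simpl; field; lra).
  assert (E : Theta_mix p m alpha beta mu H z = (RtoC K * l - RtoC K + 1)%C).
  { apply (cpseries_unique _ _ _ _ HH).
    assert (HS := cpseries_unit_head _ _ _ (cpseries_scal _ (RtoC K) _ _ Hl)).
    replace (RtoC K * l - RtoC K + 1)%C with
      (RtoC K * l - RtoC K * (q2 O * (q1 O * RtoC (moment gam 0))) + 1)%C
      by (rewrite Hd0; simpl; ring).
    revert HS; apply cpseries_ext; intros [|n]; [reflexivity|].
    unfold unit_head, q1, q2, unit_head.
    assert (EK : RtoC 1 = (RtoC K * RtoC ((1 - B1) / (A1 - B1))
                           * RtoC ((1 - B2) / (A2 - B2)))%C).
    { rewrite <- !RtoC_mult; f_equal; unfold K; field; lra. }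
    transitivity (RtoC 1 * (c2 (S n) * (c1 (S n) * RtoC (moment gam (S n)))))%C;
      [rewrite EK|]; ring. }
  rewrite E; unfold Cminus; rewrite !re_plus, re_scal_l, re_opp, !re_RtoC.
  (* The weak bound at the intermediate radius [r] becomes strict at 1. *)
  assert (Hdec := pfaff_decreasing gam r 1 Hg ltac:(generalize (Cmod_ge_0 z); unfold r; lra)).
  replace (4 * (A1 - B1) * (A2 - B2) / ((1 - B1) * (1 - B2))) with (4 * K)
    by (unfold K; field; lra).
  nra.
Qed.

(** * Extremal functions and sharpness *)

Definition extremal_coef (A : R) (k : nat) : C :=
  RtoC ((1 + A) * moment gam (k - p) / powerRZ (ratio p alpha beta k) m).

Definition extremal (A : R) : C -> C := CPSeries (normalized p (extremal_coef A)).

Lemma tame_extremal (A : R) : tame (normalized p (extremal_coef A)).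
Proof.
  assert (Hg := gam_pos p alpha beta hbeta hab mu hmu).
  assert (H := tame_powerRZ_ratio p alpha beta hbeta hab (- m)
                 (fun k => RtoC ((1 + A) * moment gam (k - p)))).
  assert (Hb : tame (fun k => RtoC ((1 + A) * moment gam (k - p)))).
  { apply (tame_bounded _ (Rabs (1 + A))); intros n.
    generalize (moment_bounds gam (n - p) Hg) (Rabs_pos (1 + A)); intros H1 H2.
    rewrite Cmod_R, Rabs_mult, (Rabs_pos_eq (moment gam _)) by lra; nra. }
  apply (tame_le _ _ (H Hb)); intros k; apply Req_le; f_equal.
  apply normalized_ext; intros j Hj; unfold extremal_coef.
  rewrite powerRZ_neg', <- RtoC_mult; f_equal; unfold Rdiv; ring.
Qed.

Lemma extremal_Ap (A : R) : Ap p (extremal A).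
Proof.
  split; [apply CPSeries_analytic, tame_extremal|].
  exists (extremal_coef A); apply CPSeries_expansion, tame_extremal.
Qed.

(** [extremal_coef] is obtained by solving this equation: [1 + A] is every Taylor coefficient of
    positive index of [(1 + A * z) / (1 - z)]. *)
Lemma extremal_mix_coef (A : R) (n : nat) :
  mix_coef p alpha beta mu m (extremal_coef A) n = RtoC (1 + A).
Proof.
  assert (Hg := gam_pos p alpha beta hbeta hab mu hmu).
  assert (Hm := moment_bounds gam n Hg).
  assert (Hl := ratio_bounds p alpha beta hbeta hab (p + n) ltac:(lia)).
  assert (Hp : 0 < powerRZ (ratio p alpha beta (p + n)) m)
    by (apply powerRZ_lt; lra).
  unfold mix_coef, extremal_coef; rewrite <- RtoC_mult; f_equal.
  replace (p + n - p)%nat with n by lia.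
  field; lra.
Qed.

Lemma extremal_subordinate (A : R) :
  subordinate (Theta_mix p m alpha beta mu (extremal A)) (janowski A (-1)).
Proof.
  (* The mixture is the Janowski function itself, so the identity is the subordinating map. *)
  exists (fun z => z); split; [|split; [|split]]; try easy.
  { intros z _; exists (RtoC 1).
    split; [apply (is_linear_scal_l (K := C_AbsRing) (V := C_NormedModule))|].
    intros x _ eps; apply filter_forall; intros y.
    change (Cmod (y - x - (y - x) * 1)%C <= eps * Cmod (y - x)%C).
    assert (E0 : (y - x - (y - x) * 1)%C = RtoC 0) by ring.
    rewrite E0, Cmod_0.
    apply Rmult_le_pos; [apply Rlt_le, cond_pos|apply Cmod_ge_0]. }
  intros z Hz.
  assert (H := Theta_mix_series p alpha beta hbeta hab mu hmu m (extremal A)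
                 (extremal_coef A) z (CPSeries_expansion _ (tame_extremal A)) Hz).
  assert (Hne := one_minus_neq_0 z Hz).
  assert (HG := cpseries_unit_head _ _ _ (cpseries_scal _ (RtoC (1 + A)) _ _
                  (cpseries_geometric z Hz))).
  replace (janowski A (-1) z)
    with (RtoC (1 + A) * / (1 - z) - RtoC (1 + A) * 1 + 1)%C.
  - apply (cpseries_unique _ _ _ _ H); revert HG; apply cpseries_ext.
    intros [|n]; [reflexivity|]; unfold unit_head.
    rewrite extremal_mix_coef; ring.
  - unfold janowski; rewrite RtoC_plus.
    replace (1 + RtoC (-1) * z)%C with (1 - z)%C
      by (replace (-1) with (- (1)) by ring; rewrite RtoC_opp; ring).
    field; exact Hne.
Qed.

Lemma extremal_value (A1 A2 t : R) :
  0 <= t < 1 ->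
  Re (Theta_mix p m alpha beta mu (Theta p m alpha beta
        (hadamard p (extremal A1) (extremal A2))) (RtoC (- t)))
  = 1 - (1 + A1) * (1 + A2) * (1 - pfaff gam t).
Proof.
  intros Ht.
  assert (Hg := gam_pos p alpha beta hbeta hab mu hmu).
  assert (Hz : in_U (RtoC (- t))).
  { unfold in_U; rewrite Cmod_R, Rabs_Ropp, Rabs_pos_eq; lra. }
  assert (HH := Theta_mix_hadamard_series p alpha beta hbeta hab mu hmu m
    _ _ _ _ _ (CPSeries_expansion _ (tame_extremal A1))
    (CPSeries_expansion _ (tame_extremal A2)) Hz).
  destruct (tame_convergent _ _ (tame_moment gam Hg) Hz) as [l Hl].
  assert (El : Re l = pfaff gam t).
  { rewrite <- (moment_ray_neg gam t Hg Ht); symmetry.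
    apply Re_cpseries_ray.
    rewrite <- RtoC_mult; replace (t * -1) with (- t) by ring; exact Hl. }
  assert (HS := cpseries_unit_head _ _ _
                  (cpseries_scal _ (RtoC ((1 + A1) * (1 + A2))) _ _ Hl)).
  unfold extremal; rewrite (cpseries_unique _ _ _
    (RtoC ((1 + A1) * (1 + A2)) * l
     - RtoC ((1 + A1) * (1 + A2)) * RtoC (moment gam 0) + 1)%C HH).
  - replace (moment gam 0) with 1 by (unfold moment; simpl; field; lra).
    rewrite <- RtoC_mult; unfold Cminus.
    rewrite !re_plus, re_scal_l, re_opp, !re_RtoC, El; ring.
  - revert HS; apply cpseries_ext; intros [|n]; [reflexivity|].
    unfold unit_head; rewrite !extremal_mix_coef, RtoC_mult; ring.
Qed.

(** The point -1 is outside the disc, so the bound is only approached, at [- t] with [t] tending to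
    1; continuity of [pfaff] at 1 transfers the inequality to the limit. *)
Lemma hadamard_Re_bound_sharp (A1 A2 c : R) :
  -1 < A1 -> -1 < A2 -> Re_bound p m alpha beta mu A1 (-1) A2 (-1) c ->
  c <= 1 - (1 + A1) * (1 + A2) * (1 - pfaff gam 1).
Proof.
  intros HA1 HA2 Hc.
  assert (Hg := gam_pos p alpha beta hbeta hab mu hmu).
  assert (HK : 0 < (1 + A1) * (1 + A2)) by nra.
  assert (Hlt : forall t, 0 <= t < 1 ->
    c <= 1 - (1 + A1) * (1 + A2) * (1 - pfaff gam t)).
  { intros t Ht; rewrite <- (extremal_value A1 A2 t Ht).
    apply Rlt_le, Hc; try apply extremal_Ap; try apply extremal_subordinate.
    unfold in_U; rewrite Cmod_R, Rabs_Ropp, Rabs_pos_eq; lra. }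
  apply Rnot_lt_le; intros Hgt.
  (* The supposed excess of [c], rescaled to a tolerance for [pfaff]. *)
  set (e := (c - (1 - (1 + A1) * (1 + A2) * (1 - pfaff gam 1)))
            / ((1 + A1) * (1 + A2))).
  assert (He : 0 < e) by (apply Rdiv_lt_0_compat; lra).
  assert (Hcont : continuous (pfaff gam) 1).
  { apply (ex_derive_continuous (V := R_NormedModule)).
    destruct (pfaff_ode gam 1 Hg) as [s [Hs _]]; [lra|now exists s]. }
  assert (Hloc := proj1 (filterlim_locally (F := locally 1) (pfaff gam) (pfaff gam 1)) Hcont
                    (mkposreal e He)).
  destruct Hloc as [delta Hdelta].
  assert (Hd := cond_pos delta).
  set (x := Rmin (delta / 2) 1).
  assert (Hx0 : 0 < x) by (apply Rmin_glb_lt; lra).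
  assert (Hx1 : x <= delta / 2) by apply Rmin_l.
  assert (Hx2 : x <= 1) by apply Rmin_r.
  specialize (Hlt (1 - x) ltac:(lra)).
  assert (Hb : Rabs (pfaff gam (1 - x) - pfaff gam 1) < e).
  { apply (Hdelta (1 - x)).
    change (Rabs (1 - x - 1) < delta).
    replace (1 - x - 1) with (- x) by ring.
    rewrite Rabs_Ropp, Rabs_pos_eq; lra. }
  apply Rabs_lt_between in Hb.
  assert (Ee : e * ((1 + A1) * (1 + A2))
               = c - (1 - (1 + A1) * (1 + A2) * (1 - pfaff gam 1)))
    by (unfold e; field; lra).
  nra.
Qed.

End Bound.

Theorem theorem4p6
    (p : nat) (m : Z) (alpha beta mu A1 B1 A2 B2 eta : R)
    (hp : (1 <= p)%nat)
    (hbeta : 0 < beta)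
    (hab : 0 < alpha + INR p * beta)
    (hmu : 0 < mu)
    (h1 : -1 <= B1 /\ B1 < A1 /\ A1 <= 1)
    (h2 : -1 <= B2 /\ B2 < A2 /\ A2 <= 1)
    (eta_def : eta =
       1 - 4 * (A1 - B1) * (A2 - B2) / ((1 - B1) * (1 - B2))
           * (1 - 1 / 2 * hyp2F1 1 1
                            ((alpha + INR p * beta) / (mu * beta) + 1) (1 / 2)))
    (heta : 0 <= eta < 1) :
  Re_bound p m alpha beta mu A1 B1 A2 B2 eta
  /\
  (B1 = -1 -> B2 = -1 ->
   forall c : R, Re_bound p m alpha beta mu A1 B1 A2 B2 c -> c <= eta).
Proof.
  rewrite <- pfaff_1 in eta_def; subst eta; split.
  - now apply hadamard_Re_bound.
  - intros -> -> c Hc.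
    replace (4 * (A1 - -1) * (A2 - -1) / ((1 - -1) * (1 - -1)))
      with ((1 + A1) * (1 + A2)) by field.
    apply (hadamard_Re_bound_sharp p m alpha beta mu); trivial; lra.
Qed.
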